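(* Let $\mathcal{X}\subseteq\mathbb{R}^d$ be a nonempty closed convex bounded set, let $R\ge\max_{x,y\in\mathcal{X}}\|x-y\|$ and $R_\infty\ge\max_{x,y\in\mathcal{X}}\|x-y\|_\infty$. Let $F\colon\mathcal{X}\to\mathbb{R}^d$ be a monotone operator accessed via a stochastic oracle with variance parameter $\sigma^2$. Run Algorithm AdaPEG-Vector (described in the context) with $\gamma_0\ge0$ and $\eta=R_\infty$, and let $\bar x_T$ be its output. If $F$ is non-smooth (no smoothness assumption), then \[\mathbb{E}[\mathrm{Err}(\bar x_T)]\le O\left(\frac{\gamma_0dR_\infty^2}{T}+\frac{\sqrt d R_\infty G+(\sqrt dR_\infty+R)\sigma}{\sqrt T}\right),\] where $G=\max_{x\in\mathcal{X}}\|F(x)\|$. If $F$ is $\beta$-smooth with respect to the $\ell_2$-norm, then \[\mathbb{E}[\mathrm{Err}(\bar x_T)]\le O\left(\frac{\gamma_0dR_\infty^2+\gamma_0^{-1}dR_\infty^2\beta^2}{T}+\frac{(\sqrt dR_\infty+R)\sigma}{\sqrt T}\right).\]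
   Context: $\|\cdot\|$ is the Euclidean norm; for a positive semidefinite diagonal matrix $A$, $\|x\|_A^2=x^\top Ax$; $A_i$ denotes the $i$-th diagonal entry and $v_i$ the $i$-th coordinate of a vector $v$. Monotone: $\langle F(x)-F(y),x-y\rangle\ge0$; $\beta$-smooth: $\|F(x)-F(y)\|\le\beta\|x-y\|$. Stochastic oracle: queried at $x_t$ it returns a random $\widehat{F(x_t)}$ with $\mathbb{E}[\widehat{F(x_t)}\mid x_1,\dots,x_t]=F(x_t)$ and $\mathbb{E}\|\widehat{F(x_t)}-F(x_t)\|^2\le\sigma^2$. $\mathrm{Err}(x)=\sup_{y\in\mathcal{X}}\langle F(y),x-y\rangle$. Algorithm AdaPEG-Vector: $x_0=z_0\in\mathcal{X}$, $D_0=\gamma_0I$, $\eta>0$. For $t=1,\dots,T$: $x_t=\arg\min_{u\in\mathcal{X}}\{\langle\widehat{F(x_{t-1})},u\rangle+\tfrac12\|u-z_{t-1}\|_{D_{t-1}}^2\}$; $D_t$ diagonal with $D_{t,i}=\frac1\eta\sqrt{\eta^2D_{0,i}^2+\sum_{s=1}^t\big((\widehat{F(x_s)})_i-(\widehat{F(x_{s-1})})_i\big)^2}$ for $i\in[d]$; $z_t=\arg\min_{u\in\mathcal{X}}\{\langle\widehat{F(x_t)},u\rangle+\tfrac12\|u-z_{t-1}\|_{D_{t-1}}^2+\tfrac12\|u-x_t\|_{D_t-D_{t-1}}^2\}$. Output $\bar x_T=\frac1T\sum_{t=1}^Tx_t$. $O(\cdot)$ hides absolute constants. *)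

(* Defs.v *)
From HB Require Import structures.
From mathcomp Require Import all_boot all_order all_algebra.
From mathcomp Require Import all_classical all_reals all_analysis.
Set Implicit Arguments. Unset Strict Implicit. Unset Printing Implicit Defensive.
Import Order.TTheory GRing.Theory Num.Theory.
Import numFieldNormedType.Exports.
Local Open Scope classical_set_scope.
Local Open Scope ring_scope.

Section AdaPEG.
Context {R : realType} {d : nat}.

Definition dotp (u v : 'rV[R]_d) : R := \sum_(i < d) u ord0 i * v ord0 i.
Definition norm2 (u : 'rV[R]_d) : R := Num.sqrt (dotp u u).
(* ||u||_D^2 for the diagonal matrix with diagonal entries Dd *)
Definition sqnormD (Dd u : 'rV[R]_d) : R := \sum_(i < d) Dd ord0 i * (u ord0 i) ^+ 2.

Definition monotone_on (X : set 'rV[R]_d) (F : 'rV[R]_d -> 'rV[R]_d) : Prop :=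
  forall x y, X x -> X y -> 0 <= dotp (F x - F y) (x - y).

Definition smooth_on (X : set 'rV[R]_d) (F : 'rV[R]_d -> 'rV[R]_d) (beta : R) : Prop :=
  forall x y, X x -> X y -> norm2 (F x - F y) <= beta * norm2 (x - y).

Definition argmin_on (X : set 'rV[R]_d) (f : 'rV[R]_d -> R) (u : 'rV[R]_d) : Prop :=
  X u /\ forall v, X v -> f u <= f v.

Definition Err (X : set 'rV[R]_d) (F : 'rV[R]_d -> 'rV[R]_d) (x : 'rV[R]_d) : \bar R :=
  ereal_sup [set (dotp (F y) (x - y))%:E | y in X].

(* diagonal of D_t; g s = oracle answer \hat F(x_s) *)
Definition Ddiag (eta gamma0 : R) (g : nat -> 'rV[R]_d) (t : nat) : 'rV[R]_d :=
  if t is 0 then const_mx gamma0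
  else \row_(i < d) (eta^-1 * Num.sqrt (eta ^+ 2 * gamma0 ^+ 2 +
          \sum_(1 <= s < t.+1) (g s ord0 i - g s.-1 ord0 i) ^+ 2)).

Definition adapeg_run (X : set 'rV[R]_d) (eta gamma0 : R) (x0 : 'rV[R]_d)
    (g x z : nat -> 'rV[R]_d) (T : nat) : Prop :=
  let D := Ddiag eta gamma0 g in
  x 0%N = x0 /\ z 0%N = x0 /\
  forall t, (1 <= t <= T)%N ->
    argmin_on X (fun u => dotp (g t.-1) u + sqnormD (D t.-1) (u - z t.-1) / 2) (x t) /\
    argmin_on X (fun u => dotp (g t) u + sqnormD (D t.-1) (u - z t.-1) / 2
                          + sqnormD (D t - D t.-1) (u - x t) / 2) (z t).

Definition xbar (x : nat -> 'rV[R]_d) (T : nat) : 'rV[R]_d :=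
  (T%:R)^-1 *: \sum_(1 <= t < T.+1) x t.

Definition gen_sigma {T0 : Type} (x : nat -> T0 -> 'rV[R]_d) (t : nat) : set (set T0) :=
  <<s [set A | exists (s : nat) (i : 'I_d) (B : set R),
         [/\ (1 <= s <= t)%N, measurable B & A = (fun w => x s w ord0 i) @^-1` B] ] >>.

End AdaPEG.

Definition is_cond_exp {R : realType} {dO : measure_display} {O : measurableType dO}
    (P : probability O R) (G : set (set O)) (Y Z : O -> R) : Prop :=
  [/\ (forall A, G A -> measurable A),
      P.-integrable setT (fun w => (Y w)%:E),
      P.-integrable setT (fun w => (Z w)%:E),
      (forall B : set R, measurable B -> G (Z @^-1` B)) &
      (forall A, G A -> (\int[P]_(w in A) (Y w)%:E = \int[P]_(w in A) (Z w)%:E)%E)].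

(* Main.v *)
Require Import Defs.
From HB Require Import structures.
From mathcomp Require Import all_boot all_order all_algebra.
From mathcomp Require Import all_classical all_reals all_analysis.
From mathcomp Require Import measurable_realfun ring lra.
Import Order.TTheory GRing.Theory Num.Theory.
Import numFieldNormedType.Exports.
Local Open Scope classical_set_scope.
Local Open Scope ring_scope.

(** The oracle is unbiased only given [x_1, ..., x_t], and the past noise need not
    be a function of these points, so the sum of the noise vectors is not a
    martingale and cannot be bounded as [sigma sqrt T].  The noise is avoided
    altogether by moving the comparator.  If [Y] is a maximiser of the gap,
    chosen as a function of [x_1, ..., x_T], and [Y_t] is its conditional
    expectation given [x_1, ..., x_t], then
      [E <F(x_t), x_t - Y> = E <F(x_t), x_t - Y_t> = E <g_t, x_t - Y_t>],
    and the last sum is the regret of the algorithm against the moving comparator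
    [Y_t].  Compared with a fixed comparator, this regret contains the additional
    terms [D_t (Y_{t+1} - Y_t) B_t] with [B_t] bounded and adapted.  As [D_t] is
    nondecreasing, summation by parts bounds their sum by [2 D_T] times the
    maximum of a martingale transform of [Y], whose second moment is controlled by
    Doob's inequality.  AM-GM then leaves the second moment of [D_T], which is
    explicit.

    To have conditional expectations at hand, [x_t] and [F(x_t)] are rounded to a
    grid of mesh [eps]; the filtration then consists of finite algebras, and
    [eps] tends to 0 at the end. *)

(** * Regret against a moving comparator, one coordinate *)

Section ScalarRegret.
Context {R : realFieldType}.

(** Summation by parts: as [D] is nondecreasing and [a] nonnegative, every term left over besides
    the boundary term [D n * a n.+1] is nonpositive. *)
Lemma weighted_telescope_le (D a : nat -> R) n :
  (forall t, 0 <= D t) -> (forall t, D t <= D t.+1) -> (forall t, 0 <= a t) ->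
  \sum_(t < n) D t.+1 * (a t.+2 - a t.+1) <= D n * a n.+1.
Proof.
move=> D0 DS a0; elim: n => [|n IH]; first by rewrite big_ord0 mulr_ge0.
rewrite big_ord_recr /=.
have := ler_wpM2r (a0 n.+1) (DS n); lra.
Qed.

(** AM-GM gives [de * a <= D / 4 * a ^+ 2 + de ^+ 2 / D], and [D ^+ 2 - D' ^+ 2 <= 2 * D * (D - D')]
    turns the last term into a telescoping one. *)
Lemma adaptive_step_le (rho D D' de a : R) : 0 <= D' -> D' <= D ->
  de ^+ 2 = rho ^+ 2 * (D ^+ 2 - D' ^+ 2) ->
  de * a <= D / 4 * a ^+ 2 + 2 * rho ^+ 2 * (D - D').
Proof.
move=> D'0 D'D hde.
have D0 : 0 <= D by lra.
have [D00|Dn0] := eqVneq D 0.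
  have D'00 : D' = 0 by lra.
  have -> : de = 0 by apply/eqP; rewrite -sqrf_eq0 hde D00 D'00 subrr mulr0.
  have := sqr_ge0 rho; nra.
have Dp : 0 < D by rewrite lt_def Dn0.
rewrite -(ler_pM2l Dp).
have e1 : 0 <= (D / 2 * a - de) ^+ 2 by exact: sqr_ge0.
have e2 : de ^+ 2 <= 2 * rho ^+ 2 * (D - D') * D.
  rewrite hde; have := sqr_ge0 rho; nra.
lra.
Qed.

(** Passing from [Y] to [Y'] in the distance to [z] costs [D * ((Y' - Y) * (Y - z)) + D / 2 * (Y' -
    Y) ^+ 2]. The factor [Y - z] is split through [xt] and [x]; the product with [x - z] goes by
    AM-GM. Of the available [D / 2 * (z - x) ^+ 2], the share [D / 4] pays for [de], [D / 8] for
    this product, and [D / 8] remains. *)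
Lemma dynamic_step_le (rho eps D D' de x z z' Y Y' x0 xt : R) :
  0 <= D' -> D' <= D -> de ^+ 2 = rho ^+ 2 * (D ^+ 2 - D' ^+ 2) ->
  `|Y - x| <= rho -> `|Y' - Y| <= rho -> `|xt - x| <= eps ->
  de * (x - z) - D / 2 * (z - x) ^+ 2 - D' / 2 * (x - z') ^+ 2
  + D' / 2 * (Y - z') ^+ 2 - D / 2 * (Y - z) ^+ 2 + (D - D') / 2 * (Y - x) ^+ 2
  <= D' / 2 * (Y - z') ^+ 2 - D / 2 * (Y' - z) ^+ 2 + 5 / 2 * rho ^+ 2 * (D - D')
     + 5 / 2 * (D * ((Y' - x0) ^+ 2 - (Y - x0) ^+ 2))
     + D * ((Y' - Y) * (Y - xt - 5 * (Y - x0))) + D * (rho * eps)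
     - (D / 8 * (x - z) ^+ 2 + D' / 2 * (x - z') ^+ 2).
Proof.
move=> D'0 D'D hde Yx YY xtx.
have D0 : 0 <= D by lra.
have h1 := adaptive_step_le rho D D' de (x - z) D'0 D'D hde.
have h2 : (D - D') * (Y - x) ^+ 2 <= (D - D') * rho ^+ 2.
  by rewrite ler_wpM2l ?subr_ge0// -real_normK ?num_real// lerXn2r ?nnegrE// (le_trans _ Yx).
have h3 : D * ((Y' - Y) * (x - z)) <= D * ((x - z) ^+ 2 / 8 + 2 * (Y' - Y) ^+ 2).
  rewrite ler_wpM2l//.
  have := sqr_ge0 ((x - z) / 4 - (Y' - Y)); nra.
have h4 : D * ((Y' - Y) * (xt - x)) <= D * (rho * eps).
  rewrite ler_wpM2l// (le_trans (ler_norm _))// normrM ler_pM//.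
lra.
Qed.

(** The factor 6 is [5 / 2 + 5 / 2 + 1]: the growth of [D], the squares [(Y - x0) ^+ 2], and the
    rounding. The negative sum is kept to absorb the variation of a smooth field. *)
Lemma coordinate_regret (rho gamma0 eps m x0 : R) (D de x z Y xt M : nat -> R) n :
  0 <= gamma0 -> D 0%N = gamma0 -> (forall t, D t <= D t.+1) ->
  (forall t, de t.+1 ^+ 2 = rho ^+ 2 * (D t.+1 ^+ 2 - D t ^+ 2)) ->
  x 0%N = z 0%N -> 0 <= eps -> n%:R * eps <= rho ->
  (forall t, (t < n)%N -> `|Y t.+1 - x t.+1| <= rho) ->
  (forall t, (t < n)%N -> `|xt t.+1 - x t.+1| <= eps) ->
  `|Y 1%N - z 0%N| <= rho -> (forall t, `|Y t - x0| <= rho) ->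
  (forall t, `|Y t.+1 - Y t| <= rho) ->
  (forall t, M t.+1 = M t + (Y t.+1 - Y t) * (Y t - xt t - 5 * (Y t - x0))) ->
  (forall t, (t <= n.+1)%N -> `|M t| <= m) ->
  \sum_(t < n) (de t.+1 * (x t.+1 - z t.+1) - D t.+1 / 2 * (z t.+1 - x t.+1) ^+ 2
     - D t / 2 * (x t.+1 - z t) ^+ 2 + D t / 2 * (Y t.+1 - z t) ^+ 2
     - D t.+1 / 2 * (Y t.+1 - z t.+1) ^+ 2
     + (D t.+1 - D t) / 2 * (Y t.+1 - x t.+1) ^+ 2)
  <= 6 * rho ^+ 2 * D n + 2 * D n * m
     - gamma0 / 16 * \sum_(t < n) (x t.+1 - x t) ^+ 2.
Proof.
move=> g0 D0 DS hde xz0 eps0 neps Yx xtx Yz Yx0 YY MS Mm.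
have Dg t : gamma0 <= D t by elim: t => [|t]; rewrite ?D0// => /le_trans; apply.
have Dge0 t : 0 <= D t by exact: le_trans (Dg t).
have Dle s t : (s <= t)%N -> D s <= D t.
  by move=> /subnK <-; elim: (t - s)%N => // k /le_trans; apply; rewrite addSn.
have rho0 : 0 <= rho by exact: le_trans (Yx0 0%N).
have sqle a : `|a| <= rho -> a ^+ 2 <= rho ^+ 2.
  by move=> ar; rewrite -real_normK ?num_real// lerXn2r ?nnegrE.
have neg : gamma0 / 16 * (\sum_(t < n) (x t.+1 - x t) ^+ 2) + D n / 8 * (x n - z n) ^+ 2
    <= \sum_(t < n) (D t.+1 / 8 * (x t.+1 - z t.+1) ^+ 2 + D t / 2 * (x t.+1 - z t) ^+ 2).
  elim: (n) => [|k IH]; first by rewrite !big_ord0 xz0 subrr expr0n /= !mulr0 addr0.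
  rewrite !big_ord_recr /=.
  suff : gamma0 / 16 * (x k.+1 - x k) ^+ 2
      <= D k / 8 * (x k - z k) ^+ 2 + D k / 2 * (x k.+1 - z k) ^+ 2 by lra.
  apply: (@le_trans _ _ (D k / 16 * (x k.+1 - x k) ^+ 2)).
    by rewrite ler_wpM2r ?sqr_ge0//; have := Dg k; lra.
  rewrite -subr_ge0.
  have -> : D k / 8 * (x k - z k) ^+ 2 + D k / 2 * (x k.+1 - z k) ^+ 2
      - D k / 16 * (x k.+1 - x k) ^+ 2 =
      D k * ((x k + x k.+1 - 2 * z k) ^+ 2 / 16 + 3 / 8 * (x k.+1 - z k) ^+ 2) by field.
  apply: mulr_ge0 => //.
  have := sqr_ge0 (x k + x k.+1 - 2 * z k); have := sqr_ge0 (x k.+1 - z k); lra.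
have tel : \sum_(t < n) (D t / 2 * (Y t.+1 - z t) ^+ 2 - D t.+1 / 2 * (Y t.+2 - z t.+1) ^+ 2
     + 5 / 2 * rho ^+ 2 * (D t.+1 - D t))
   = D 0%N / 2 * (Y 1%N - z 0%N) ^+ 2 - D n / 2 * (Y n.+1 - z n) ^+ 2
     + 5 / 2 * rho ^+ 2 * (D n - D 0%N).
  elim: (n) => [|k IH]; first by rewrite big_ord0; ring.
  by rewrite big_ord_recr /= IH; ring.
have sq := weighted_telescope_le D (fun t => (Y t - x0) ^+ 2) n Dge0 DS
  (fun t => sqr_ge0 _).
have mart : \sum_(t < n) D t.+1 * ((Y t.+2 - Y t.+1) * (Y t.+1 - xt t.+1 - 5 * (Y t.+1 - x0)))
    <= 2 * D n * m.
  (* Adding [m] makes the sequence nonnegative; the cut-off is there because [m] bounds [M] only up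
     to [n.+1]. *)
  pose a t := m + (if (t <= n.+1)%N then M t else 0).
  have a0 t : 0 <= a t.
    rewrite /a; case: ifP => [/Mm|_]; first by rewrite ler_norml; lra.
    by rewrite addr0; apply: le_trans (Mm 0%N isT).
  have := weighted_telescope_le D a n Dge0 DS a0.
  have -> : \sum_(t < n) D t.+1 * (a t.+2 - a t.+1) =
    \sum_(t < n) D t.+1 * ((Y t.+2 - Y t.+1) * (Y t.+1 - xt t.+1 - 5 * (Y t.+1 - x0))).
    apply: eq_bigr => t _; rewrite /a !ltnS ltn_ord (ltnW (ltn_ord t)) MS.
    congr (_ * _); ring.
  move=> /le_trans; apply; rewrite /a leqnn.
  have := Mm n.+1 (leqnn _); rewrite ler_norml => /andP[_ Mnm].
  have := ler_wpM2l (Dge0 n) Mnm; lra.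
have err : \sum_(t < n) D t.+1 * (rho * eps) <= D n * rho ^+ 2.
  apply: (@le_trans _ _ (\sum_(t < n) D n * (rho * eps))).
    by apply: ler_sum => t _; rewrite ler_wpM2r ?mulr_ge0// Dle.
  rewrite sumr_const card_ord -mulr_natl.
  have := ler_wpM2l (mulr_ge0 (Dge0 n) rho0) neps; lra.
have : \sum_(t < n) (de t.+1 * (x t.+1 - z t.+1) - D t.+1 / 2 * (z t.+1 - x t.+1) ^+ 2
     - D t / 2 * (x t.+1 - z t) ^+ 2 + D t / 2 * (Y t.+1 - z t) ^+ 2
     - D t.+1 / 2 * (Y t.+1 - z t.+1) ^+ 2
     + (D t.+1 - D t) / 2 * (Y t.+1 - x t.+1) ^+ 2)
  <= \sum_(t < n) (D t / 2 * (Y t.+1 - z t) ^+ 2 - D t.+1 / 2 * (Y t.+2 - z t.+1) ^+ 2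
     + 5 / 2 * rho ^+ 2 * (D t.+1 - D t))
   + 5 / 2 * \sum_(t < n) D t.+1 * ((Y t.+2 - x0) ^+ 2 - (Y t.+1 - x0) ^+ 2)
   + \sum_(t < n) D t.+1 * ((Y t.+2 - Y t.+1) * (Y t.+1 - xt t.+1 - 5 * (Y t.+1 - x0)))
   + \sum_(t < n) D t.+1 * (rho * eps)
   - \sum_(t < n) (D t.+1 / 8 * (x t.+1 - z t.+1) ^+ 2 + D t / 2 * (x t.+1 - z t) ^+ 2).
  rewrite mulr_sumr -!big_split /= -sumrB; apply: ler_sum => t _.
  have := @dynamic_step_le rho eps (D t.+1) (D t) (de t.+1) (x t.+1) (z t.+1) (z t)
     (Y t.+1) (Y t.+2) x0 (xt t.+1) (Dge0 t) (DS t) (hde t) (Yx t (ltn_ord t)) (YY t.+1)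
     (xtx t (ltn_ord t)); lra.
move=> /le_trans; apply; rewrite tel.
have b0 := ler_wpM2l (Dge0 0%N) (sqle _ Yz).
have b1 := ler_wpM2l (Dge0 n) (sqle _ (Yx0 n.+1)).
have b2 : 0 <= D n * (Y n.+1 - z n) ^+ 2 by rewrite mulr_ge0// sqr_ge0.
have b3 : 0 <= D n / 8 * (x n - z n) ^+ 2 by rewrite mulr_ge0 ?sqr_ge0// divr_ge0.
have b4 : 0 <= rho ^+ 2 * D 0%N by rewrite mulr_ge0 ?sqr_ge0.
rewrite /= in sq; lra.
Qed.

End ScalarRegret.

(** * Martingales over a finite algebra *)

Section FiniteMartingale.
Context {R : realFieldType} {K : finType}.
Variables (p : K -> R) (r : nat -> K -> K).
Hypothesis p_ge0 : forall k, 0 <= p k.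
Hypothesis r_refines :
  forall s t k k', (s <= t)%N -> r t k = r t k' -> r s k = r s k'.

Definition fexp (f : K -> R) : R := \sum_k p k * f k.

Definition atom_mass (t : nat) (k : K) : R := \sum_(k' | r t k' == r t k) p k'.

(* On an atom of mass 0 the division makes [fcond] equal to 0. *)
Definition fcond (t : nat) (f : K -> R) (k : K) : R :=
  (\sum_(k' | r t k' == r t k) p k' * f k') / atom_mass t k.

(** The value [r t k] labels the atom of time [t] containing [k]; for a finite algebra,
    measurability is constancy on atoms. *)
Definition adapted_at {V : Type} (t : nat) (f : K -> V) : Prop :=
  forall k k', r t k = r t k' -> f k = f k'.

Lemma adapted_at_le (V : Type) s t (f : K -> V) :
  (s <= t)%N -> adapted_at s f -> adapted_at t f.
Proof. by move=> st fs k k' /(r_refines _ _ _ _ st); exact: fs. Qed.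

Lemma atom_mass_adapted t : adapted_at t (atom_mass t).
Proof. by move=> k k' e; rewrite /atom_mass e. Qed.

Lemma fcond_adapted t f : adapted_at t (fcond t f).
Proof. by move=> k k' e; rewrite /fcond (atom_mass_adapted t k k' e) e. Qed.

Lemma fexpD f h : fexp (fun k => f k + h k) = fexp f + fexp h.
Proof. by rewrite /fexp -big_split; apply: eq_bigr => k _; rewrite mulrDr. Qed.

Lemma fexpZ a f : fexp (fun k => a * f k) = a * fexp f.
Proof. by rewrite /fexp mulr_sumr; apply: eq_bigr => k _; rewrite mulrCA. Qed.

Lemma fexpB f h : fexp (fun k => f k - h k) = fexp f - fexp h.
Proof. by rewrite /fexp -sumrB; apply: eq_bigr => k _; rewrite mulrBr. Qed.

Lemma fexp_sum n (f : nat -> K -> R) :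
  fexp (fun k => \sum_(t < n) f t k) = \sum_(t < n) fexp (f t).
Proof.
by rewrite /fexp exchange_big; apply: eq_bigr => k _; rewrite mulr_sumr.
Qed.

Lemma eq_fexp f h : f =1 h -> fexp f = fexp h.
Proof. by move=> e; apply: eq_bigr => k _; rewrite e. Qed.

Lemma le_fexp f h : (forall k, f k <= h k) -> fexp f <= fexp h.
Proof. by move=> fh; apply: ler_sum => k _; rewrite ler_wpM2l. Qed.

Lemma atom_mass_ge0 t k : 0 <= atom_mass t k.
Proof. exact: sumr_ge0. Qed.

Lemma atom_mass_eq0 t k : atom_mass t k = 0 -> p k = 0.
Proof.
by move=> /eqP; rewrite psumr_eq0// => /allP/(_ k (mem_index_enum _)); rewrite eqxx => /eqP.
Qed.

(** Exchange of the two sums; on an atom of mass 0 both sides vanish, because [p] does. *)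
Lemma fexp_fcond t f phi : adapted_at t phi ->
  fexp (fun k => phi k * fcond t f k) = fexp (fun k => phi k * f k).
Proof.
move=> aphi; rewrite /fexp /fcond.
under eq_bigr do rewrite mulrA mulrA mulr_sumr mulr_suml.
rewrite (exchange_big_dep xpredT)//=; apply: eq_bigr => k' _.
transitivity (\sum_(k | r t k == r t k') p k * (phi k' * (p k' * f k') / atom_mass t k')).
  apply: eq_big => [k|k /eqP e]; first by rewrite eq_sym.
  by rewrite (aphi k k')// (atom_mass_adapted t k k')// -!mulrA.
rewrite -mulr_suml -/(atom_mass t k').
have [m0|m0] := eqVneq (atom_mass t k') 0; first by rewrite (atom_mass_eq0 _ _ m0) m0 !mul0r.
by field.
Qed.

(** The condition [c <= 0] accounts for atoms of mass 0, where [fcond] is 0. *)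
Lemma fcond_ge t f c k : (forall k, c <= f k) -> c <= 0 -> c <= fcond t f k.
Proof.
move=> cf c0; have [m0|m0] := eqVneq (atom_mass t k) 0; first by rewrite /fcond m0 invr0 mulr0.
have mp : 0 < atom_mass t k by rewrite lt_def m0 atom_mass_ge0.
rewrite /fcond ler_pdivlMr// /atom_mass mulr_sumr.
by apply: ler_sum => k' _; rewrite mulrC ler_wpM2l.
Qed.

Lemma fcond_norm_le t f c k : 0 <= c -> (forall k, `|f k| <= c) -> `|fcond t f k| <= c.
Proof.
move=> c0 fc; rewrite ler_norml; apply/andP; split.
  by apply: fcond_ge; [move=> k'; have := fc k'; rewrite ler_norml => /andP[] | lra].
rewrite -lerN2; have -> : - fcond t f k = fcond t (fun k => - f k) k.
  by rewrite /fcond -mulNr -sumrN; under eq_bigr do rewrite -mulrN.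
by apply: fcond_ge; [move=> k'; have := fc k'; rewrite ler_norml => /andP[_]; lra | lra].
Qed.

Lemma fexp_increment t f phi : adapted_at t phi ->
  fexp (fun k => phi k * (fcond t.+1 f k - fcond t f k)) = 0.
Proof.
move=> aphi.
rewrite (@eq_fexp _ (fun k => phi k * fcond t.+1 f k - phi k * fcond t f k)); last first.
  by move=> k; rewrite mulrBr.
rewrite fexpB !fexp_fcond ?subrr//.
exact: adapted_at_le (leqnSn t) aphi.
Qed.

(** Martingale increments are orthogonal to the past, so the second moments of the increments add
    up. *)
Lemma fexp_sq_increments f n :
  \sum_(t < n) fexp (fun k => (fcond t.+1 f k - fcond t f k) ^+ 2)
  <= fexp (fun k => fcond n f k ^+ 2).
Proof.
elim: n => [|n IH].
  by rewrite big_ord0; apply: sumr_ge0 => k _; rewrite mulr_ge0// sqr_ge0.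
rewrite big_ord_recr /=; apply: le_trans (lerD IH (lexx _)) _.
rewrite -fexpD.
have -> : fexp (fun k => fcond n.+1 f k ^+ 2) =
  fexp (fun k => fcond n f k ^+ 2 + (fcond n.+1 f k - fcond n f k) ^+ 2
   + 2 * (fcond n f k * (fcond n.+1 f k - fcond n f k))).
  by apply: eq_fexp => k; ring.
by rewrite (fexpD _ (fun k => 2 * _)) fexpZ fexp_increment ?mulr0 ?addr0//; exact: fcond_adapted.
Qed.

(** * Martingale transforms and their running maximum *)

Section Transform.
Variables (f : K -> R) (B : nat -> K -> R) (b c : R).
Hypothesis c_ge0 : 0 <= c.
Hypothesis f_le : forall k, `|f k| <= c.
Hypothesis B_adapted : forall t, adapted_at t (B t).
Hypothesis B_le : forall t k, `|B t k| <= b.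

Definition mtransform (n : nat) (k : K) : R :=
  \sum_(t < n) (fcond t.+1 f k - fcond t f k) * B t k.

Fixpoint mrunmax (n : nat) (k : K) : R :=
  if n is n'.+1 then Num.max (mrunmax n' k) `|mtransform n k| else 0.

Lemma mtransformS n k :
  mtransform n.+1 k = mtransform n k + (fcond n.+1 f k - fcond n f k) * B n k.
Proof. by rewrite /mtransform big_ord_recr. Qed.

Lemma mtransform_adapted n : adapted_at n (mtransform n).
Proof.
elim: n => [|n IH] k k' e; first by rewrite /mtransform !big_ord0.
have e' := r_refines _ _ _ _ (leqnSn n) e.
rewrite !mtransformS (IH _ _ e') (B_adapted _ _ _ e').
by rewrite (fcond_adapted _ _ _ _ e) (fcond_adapted _ _ _ _ e').
Qed.

Lemma mrunmax_adapted n : adapted_at n (mrunmax n).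
Proof.
elim: n => [//|n IH] k k' e /=.
by rewrite (IH _ _ (r_refines _ _ _ _ (leqnSn n) e)) (mtransform_adapted _ _ _ e).
Qed.

Lemma mtransform_le_mrunmax s n k : (s <= n)%N -> `|mtransform s k| <= mrunmax n k.
Proof.
elim: n => [|n IH]; first by rewrite leqn0 => /eqP ->; rewrite /mtransform big_ord0 normr0.
by rewrite leq_eqVlt ltnS /= le_max => /predU1P[->|/IH ->//]; rewrite lexx orbT.
Qed.

(** The cross terms vanish by orthogonality, and [b] bounds the integrand, which leaves the square
    increments of the martingale itself. *)
Lemma fexp_mtransform_sq n :
  fexp (fun k => mtransform n k ^+ 2) <= b ^+ 2 * (c ^+ 2 * \sum_k p k).
Proof.
have sqle (a e : R) : `|a| <= e -> a ^+ 2 <= e ^+ 2.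
  move=> ae; have e0 : 0 <= e by exact: le_trans ae.
  by rewrite -real_normK ?num_real// lerXn2r ?nnegrE.
apply: (@le_trans _ _ (b ^+ 2 * \sum_(t < n) fexp (fun k => (fcond t.+1 f k - fcond t f k) ^+ 2))).
  elim: n => [|n IH].
    rewrite big_ord0 mulr0 /fexp big1// => k _.
    by rewrite /mtransform big_ord0 expr0n /= mulr0.
  rewrite big_ord_recr /= mulrDr -fexpZ.
  have -> : fexp (fun k => mtransform n.+1 k ^+ 2) =
      fexp (fun k => mtransform n k ^+ 2 + ((fcond n.+1 f k - fcond n f k) * B n k) ^+ 2
        + 2 * ((mtransform n k * B n k) * (fcond n.+1 f k - fcond n f k))).
    by apply: eq_fexp => k; rewrite mtransformS; ring.
  rewrite (fexpD _ (fun k => 2 * _)) fexpZ fexp_increment ?mulr0 ?addr0; last first.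
    by move=> k k' e; rewrite (mtransform_adapted _ _ _ e) (B_adapted _ _ _ e).
  rewrite fexpD; apply: lerD => //; apply: le_fexp => k.
  by rewrite exprMn mulrC ler_wpM2r ?sqr_ge0// sqle.
rewrite ler_wpM2l ?sqr_ge0//; apply: le_trans (fexp_sq_increments f n) _.
rewrite mulr_sumr; apply: ler_sum => k _.
by rewrite mulrC ler_wpM2r// sqle// fcond_norm_le.
Qed.

(* Doob's maximal inequality, from the pathwise bound
   [max^2 <= 2 max |M| - 2 sum_t max_t sgn(M_t) dM_t]. *)
Lemma fexp_mrunmax_sq n :
  fexp (fun k => mrunmax n k ^+ 2) <= 4 * (b ^+ 2 * (c ^+ 2 * \sum_k p k)).
Proof.
have mge0 k m : 0 <= mrunmax m k.
  by apply: le_trans (mtransform_le_mrunmax 0 m k _).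
have path k : mrunmax n k ^+ 2 <= 2 * (mrunmax n k * `|mtransform n k|)
   - 2 * \sum_(t < n) ((mrunmax t k * Num.sg (mtransform t k)) * B t k)
            * (fcond t.+1 f k - fcond t f k).
  elim: n => [|m IH].
    by rewrite big_ord0 /= expr0n /= !mul0r !mulr0 subrr.
  rewrite big_ord_recr /=.
  set S := \sum_(_ < _) _ in IH *.
  set a := mrunmax m k in IH *; set M := mtransform m k in IH *.
  set w := fcond m.+1 f k - fcond m f k; set M' := mtransform m.+1 k.
  have M'E : M' = M + w * B m k by rewrite /M' mtransformS.
  have sgM : `|M| + Num.sg M * (w * B m k) <= `|M'|.
    have -> : `|M| = Num.sg M * M by rewrite normrEsg.
    rewrite -mulrDr -M'E (le_trans (ler_norm _))// normrM normr_sg.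
    by case: (M != 0); rewrite ?mul1r ?mul0r.
  have a0 : 0 <= a by exact: mge0.
  have := ler_wpM2l a0 sgM.
  have aM : `|M'| <= Num.max a `|M'| by rewrite le_max lexx orbT.
  (* The maximum can only increase to the value [|M'|], and then the difference of squares is at
     most [2 * (max - a) * max]. *)
  have key : Num.max a `|M'| ^+ 2 - a ^+ 2 <= 2 * (Num.max a `|M'| - a) * `|M'|.
    have [e|e] := leP a `|M'|; last by lra.
    by have := sqr_ge0 (`|M'| - a); lra.
  rewrite mulrDr => h; lra.
have := le_fexp _ _ path; rewrite fexpB !fexpZ.
rewrite (fexp_sum n (fun t k => ((mrunmax t k * Num.sg (mtransform t k)) * B t k)
            * (fcond t.+1 f k - fcond t f k))) big1 ?mulr0 ?subr0; last first.
  move=> t _; apply: fexp_increment => k k' e.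
  by rewrite (mrunmax_adapted _ _ _ e) (mtransform_adapted _ _ _ e) (B_adapted _ _ _ e).
(* With weight [1 / 4], half of the second moment of the maximum moves to the left side, whence the
   factor 4. *)
have cs : fexp (fun k => mrunmax n k * `|mtransform n k|)
    <= fexp (fun k => 1 / 4 * mrunmax n k ^+ 2 + mtransform n k ^+ 2).
  apply: le_fexp => k.
  have := sqr_ge0 (mrunmax n k / 2 - `|mtransform n k|).
  have := @real_normK _ (mtransform n k) (num_real _); lra.
rewrite fexpD fexpZ in cs.
have := fexp_mtransform_sq n; lra.
Qed.

End Transform.
End FiniteMartingale.

(** * Bounds on expectations *)

Section MeanBounds.
Context {R : realType} {dO : measure_display} {O : measurableType dO}.
Variable P : probability O R.

(** Integrability is bundled with the bound, so that bounds can be added term by term. *)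
Definition mean_le (f : O -> R) (b : R) : Prop :=
  P.-integrable setT (EFin \o f) /\ (\int[P]_w (f w)%:E <= b%:E)%E.

Lemma mean_leW f b c : b <= c -> mean_le f b -> mean_le f c.
Proof. by move=> bc [fi fb]; split=> //; rewrite (le_trans fb)// lee_fin. Qed.

Lemma eq_mean_le f h b : f =1 h -> mean_le f b -> mean_le h b.
Proof. by move=> /funext ->. Qed.

Lemma mean_leD f h b c : mean_le f b -> mean_le h c -> mean_le (fun w => f w + h w) (b + c).
Proof.
move=> [fi fb] [hi hc]; split.
  by rewrite (_ : _ \o _ = (EFin \o f) \+ (EFin \o h))%E//; exact: integrableD.
under eq_integral do rewrite EFinD.
by rewrite integralD// EFinD leeD.
Qed.

Lemma mean_leZ f b c : 0 <= c -> mean_le f b -> mean_le (fun w => c * f w) (c * b).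
Proof.
move=> c0 [fi fb]; split.
  by rewrite (_ : _ \o _ = (fun w => c%:E * (EFin \o f) w)%E)//; exact: integrableZl.
under eq_integral do rewrite EFinM.
by rewrite integralZl// EFinM lee_wpmul2l.
Qed.

Lemma mean_le_cst c : mean_le (fun=> c) c.
Proof.
split; first exact: finite_measure_integrable_cst.
by rewrite integral_cst//= probability_setT mule1.
Qed.

Lemma mean_le_sum (I : Type) (s : seq I) (f : I -> O -> R) (b : I -> R) :
  (forall i, mean_le (f i) (b i)) ->
  mean_le (fun w => \sum_(i <- s) f i w) (\sum_(i <- s) b i).
Proof.
move=> fb; elim: s => [|i s IH].
  rewrite big_nil; apply: eq_mean_le (mean_le_cst 0) => w; by rewrite big_nil.
rewrite big_cons; apply: eq_mean_le (mean_leD _ _ _ _ (fb i) IH) => w.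
by rewrite big_cons.
Qed.

Lemma mean_le_ge0 (f : O -> R) b : measurable_fun setT f -> (forall w, 0 <= f w) ->
  (\int[P]_w (f w)%:E <= b%:E)%E -> mean_le f b.
Proof.
move=> mf f0 fb; split=> //; apply/integrableP; split; first exact/measurable_EFinP.
under eq_integral => w _ do rewrite /= ger0_norm//.
by rewrite (le_lt_trans fb)// ltry.
Qed.

(** The integral of a nonnegative function is a supremum over the simple functions below it, hence
    monotone also for [E] of unknown measurability, such as an error that is a supremum over [X]. *)
Lemma integral_le_mean (E : O -> \bar R) h b : (forall w, 0 <= E w)%E ->
  (forall w, E w <= (h w)%:E)%E -> mean_le h b -> (\int[P]_w E w <= b%:E)%E.
Proof.
move=> E0 Eh [hi hb]; apply: le_trans hb.
rewrite !ge0_integralE//; last by move=> w _; exact: le_trans (Eh w).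
rewrite !patch_setT; apply: le_ereal_sup => _ [f fE <-]; exists f => // w.
exact: le_trans (fE w) (Eh w).
Qed.

(** * Integrals involving a finite-valued code *)

Section FiniteCode.
Variables (K : finType) (c : O -> K).
Hypothesis mc : forall k, measurable [set w | c w = k].

Lemma mean_le_mul_code (xi : O -> R) (b : K -> R) :
  P.-integrable setT (EFin \o xi) ->
  mean_le (fun w => xi w * b (c w))
    (\sum_k b k * fine (\int[P]_(w in [set w | c w = k]) (xi w)%:E)).
Proof.
move=> ixi.
pose f k w := b k * (xi \_ [set w | c w = k]) w.
have fi k : P.-integrable setT (EFin \o (xi \_ [set w | c w = k])).
  rewrite (_ : _ \o _ = (EFin \o xi) \_ [set w | c w = k]); last first.
    by apply/funext => w /=; rewrite /patch; case: ifP.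
  by apply: (proj1 (integrable_mkcond _ (mc k))); apply: (integrableS measurableT _ _ ixi).
have fE w : xi w * b (c w) = \sum_k f k w.
  rewrite (bigD1 (c w))//= big1 ?addr0.
    by rewrite /f /patch mem_set// mulrC.
  move=> k kc; rewrite /f /patch memNset ?mulr0// => /= ck.
  by rewrite ck eqxx in kc.
have feq k : (\int[P]_w (f k w)%:E
    = (b k * fine (\int[P]_(w in [set w | c w = k]) (xi w)%:E))%:E)%E.
  rewrite EFinM fineK; last first.
    by apply: integrable_fin_num => //; apply: (integrableS measurableT _ _ ixi).
  rewrite -integralZl//; last exact: (integrableS measurableT _ _ ixi).
  rewrite [RHS]integral_mkcond.
  apply: eq_integral => w _; rewrite /f /patch; case: ifP => _ //.
  exact: (congr1 EFin (mulr0 (b k))).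
apply: (eq_mean_le _ _ _ (fun w => esym (fE w))).
apply: mean_le_sum => k; split; last by rewrite feq.
by rewrite (_ : _ \o _ = (fun w => (b k)%:E * (EFin \o (xi \_ [set w | c w = k])) w)%E)//;
  exact: integrableZl.
Qed.

Lemma mean_le_code (b : K -> R) :
  mean_le (fun w => b (c w)) (\sum_k fine (P [set w | c w = k]) * b k).
Proof.
have := mean_le_mul_code (fun=> 1) b (finite_measure_integrable_cst _ _ measurableT).
have -> : \sum_k b k * fine (\int[P]_(w in [set w | c w = k]) (1 : R)%:E) =
  \sum_k fine (P [set w | c w = k]) * b k.
  by apply: eq_bigr => k _; rewrite integral_cst// mul1e mulrC.
by apply: eq_mean_le => w; rewrite mul1r.
Qed.

Lemma sum_code_probability : \sum_k fine (P [set w | c w = k]) = 1.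
Proof.
have fi k : P [set w | c w = k] \is a fin_num by exact: fin_num_measure.
apply: EFin_inj; rewrite -sumEFin.
under eq_bigr do rewrite fineK//.
rewrite -(probability_setT P).
transitivity (\int[P]_w (\sum_k (\1_[set w | c w = k] w)%:E))%E.
  rewrite ge0_integral_sum//.
    by apply: eq_bigr => k _; rewrite integral_indic// setIT.
  by move=> k; apply/measurable_EFinP; exact: measurable_indic.
rewrite -[RHS]mul1e -integral_cst//; apply: eq_integral => w _.
rewrite (bigD1 (c w))//= big1 ?adde0; first by rewrite indicE mem_set.
move=> k kc; rewrite indicE memNset// => /= ck.
by rewrite ck eqxx in kc.
Qed.

End FiniteCode.
End MeanBounds.

(** * The algorithm against a moving comparator *)

Section Vectors.
Context {R : realType} {d : nat}.
Implicit Types (X : set 'rV[R]_d) (u v : 'rV[R]_d).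

Lemma convex_set_segment X u v (t : R) : convex_set X -> X u -> X v ->
  0 <= t -> t <= 1 -> X (u + t *: (v - u)).
Proof.
move=> cX Xu Xv t0 t1.
have := cX v u (Itv01 t0 t1) (mem_set Xv) (mem_set Xu); rewrite inE.
move=> h.
rewrite (_ : _ + _ = t *: v + (1 - t) *: u); first exact: h.
by rewrite scalerBr scalerBl scale1r addrCA.
Qed.

(** The missing weight sits at [u]. This form suits conditional means that degenerate to a base
    point on atoms of mass 0. Induction splits off one weight and rescales the others by
    [1 - a k]. *)
Lemma convex_set_subconvex_comb X (K : eqType) (s : seq K) (a : K -> R)
    (y : K -> 'rV[R]_d) u : convex_set X -> X u -> (forall k, X (y k)) ->
  (forall k, 0 <= a k) -> \sum_(k <- s) a k <= 1 ->
  X (u + \sum_(k <- s) a k *: (y k - u)).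
Proof.
move=> cX Xu Xy; elim: s a => [|k s IH] a a0; first by rewrite !big_nil addr0.
rewrite !big_cons => a1.
have s0 : 0 <= \sum_(j <- s) a j by exact: sumr_ge0.
have := a0 k; move: (a1); set al := a k => al_s al0.
have al1 : al <= 1 by lra.
pose b j := a j / (1 - al).
have b0 j : 0 <= b j by rewrite divr_ge0// subr_ge0.
have bs : \sum_(j <- s) b j <= 1.
  rewrite -mulr_suml; have [->|ne] := eqVneq (1 - al) 0; first by rewrite invr0 mulr0 ler01.
  by rewrite ler_pdivrMr ?mul1r; [lra | rewrite lt_def ne subr_ge0].
have := convex_set_segment X _ _ al cX (IH b b0 bs) (Xy k) al0 al1.
set S := \sum_(j <- s) b j *: _.
have SE : \sum_(j <- s) a j *: (y j - u) = (1 - al) *: S.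
  rewrite /S scaler_sumr; apply: eq_big_seq => j js; rewrite scalerA /b.
  have [e|ne] := eqVneq (1 - al) 0; last by rewrite mulrCA mulfV// mulr1.
  suff /eqP -> : a j == 0 by rewrite mul0r mulr0.
  have : \sum_(j <- s) a j == 0 by apply/eqP; lra.
  by rewrite psumr_eq0// => /allP/(_ j js).
rewrite SE; congr (X _); rewrite scalerBl scale1r !scalerBr scalerDr.
by apply/rowP => i; rewrite !mxE; ring.
Qed.

Lemma quadratic_derivative_ge0 (A Q : R) :
  (forall t, 0 < t -> t <= 1 -> 0 <= t * A + t ^+ 2 * Q) -> 0 <= A.
Proof.
move=> h; rewrite leNgt; apply/negP => A0.
have Q0 := normr_ge0 Q; have QQ := ler_norm Q.
have B0 : 0 < - A + `|Q| by lra.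
(* For this [t] one has [A + t * |Q| = t * A < 0], a contradiction. *)
pose t := - A / (- A + `|Q|).
have t0 : 0 < t by rewrite divr_gt0// oppr_gt0.
have t1 : t <= 1 by rewrite ler_pdivrMr// mul1r; lra.
have := h t t0 t1.
have -> : t * A + t ^+ 2 * Q = t * (A + t * Q) by ring.
rewrite pmulr_rge0// => h1.
have tQ : t * Q <= t * `|Q| by rewrite ler_pM2l.
have tB : t * (- A + `|Q|) = - A by rewrite /t divfK// lt0r_neq0.
have : 0 < t * - A by rewrite mulr_gt0// oppr_gt0.
lra.
Qed.

(** Along the segment from [u] to [v] the objective changes by exactly a linear plus a quadratic
    term in [t]. The second proximal term lets one statement serve both updates. *)
Lemma argmin_on_first_order X (a b p c q : 'rV[R]_d) u v : convex_set X ->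
  argmin_on X (fun u => dotp a u + sqnormD b (u - p) / 2 + sqnormD c (u - q) / 2) u ->
  X v ->
  0 <= \sum_(i < d) (a ord0 i + b ord0 i * (u ord0 i - p ord0 i)
                      + c ord0 i * (u ord0 i - q ord0 i)) * (v ord0 i - u ord0 i).
Proof.
move=> cX [Xu umin] Xv.
apply: (quadratic_derivative_ge0 _
  (\sum_(i < d) ((b ord0 i + c ord0 i) / 2) * (v ord0 i - u ord0 i) ^+ 2)) => t t0 t1.
have := umin _ (convex_set_segment X u v t cX Xu Xv (ltW t0) t1).
rewrite -subr_ge0 /dotp /sqnormD !mulr_suml -!big_split -sumrB !mulr_sumr -big_split /=.
move=> /le_trans; apply; rewrite le_eqVlt; apply/orP; left; apply/eqP.
by apply: eq_bigr => i _; rewrite !mxE; field.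
Qed.

(** Sum of the optimality condition of [x] tested at [z] and that of [z] tested at [Y]; completing
    squares coordinatewise then gives an identity. *)
Lemma extragradient_step X (g g' D D' x z z' Y : 'rV[R]_d) : convex_set X ->
  argmin_on X (fun u => dotp g' u + sqnormD D' (u - z') / 2) x ->
  argmin_on X (fun u => dotp g u + sqnormD D' (u - z') / 2 + sqnormD (D - D') (u - x) / 2) z ->
  X Y ->
  dotp g (x - Y) <= \sum_(i < d)
    ((g ord0 i - g' ord0 i) * (x ord0 i - z ord0 i)
     - D ord0 i / 2 * (z ord0 i - x ord0 i) ^+ 2
     - D' ord0 i / 2 * (x ord0 i - z' ord0 i) ^+ 2
     + D' ord0 i / 2 * (Y ord0 i - z' ord0 i) ^+ 2
     - D ord0 i / 2 * (Y ord0 i - z ord0 i) ^+ 2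
     + (D ord0 i - D' ord0 i) / 2 * (Y ord0 i - x ord0 i) ^+ 2).
Proof.
move=> cX xmin zmin XY.
have xmin' : argmin_on X (fun u => dotp g' u + sqnormD D' (u - z') / 2
    + sqnormD 0 (u - x) / 2) x.
  have s0 u : sqnormD 0 u = 0 :> R.
    by rewrite /sqnormD big1// => i _; rewrite mxE mul0r.
  by case: xmin => Xx xmin; split=> // v /xmin; rewrite !s0 mul0r !addr0.
have h1 := argmin_on_first_order _ _ _ _ _ _ _ _ cX xmin' zmin.1.
have h2 := argmin_on_first_order _ _ _ _ _ _ _ _ cX zmin XY.
rewrite -subr_ge0 /dotp -sumrB; apply: le_trans (addr_ge0 h1 h2) _.
rewrite -big_split /=; apply: ler_sum => i _; rewrite !mxE.
by rewrite le_eqVlt; apply/orP; left; apply/eqP; field.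
Qed.

Lemma Ddiag_ge0 (eta gamma0 : R) (g : nat -> 'rV[R]_d) t i : 0 < eta -> 0 <= gamma0 ->
  0 <= Ddiag eta gamma0 g t ord0 i.
Proof.
move=> e0 g0; case: t => [|t]; rewrite mxE//.
by rewrite mulr_ge0 ?sqrtr_ge0// invr_ge0 ltW.
Qed.

Lemma Ddiag_sq (eta gamma0 : R) (g : nat -> 'rV[R]_d) t i : 0 < eta -> 0 <= gamma0 ->
  eta ^+ 2 * Ddiag eta gamma0 g t ord0 i ^+ 2
  = eta ^+ 2 * gamma0 ^+ 2 + \sum_(s < t) (g s.+1 ord0 i - g s ord0 i) ^+ 2.
Proof.
move=> e0 g0; case: t => [|t]; rewrite mxE; first by rewrite big_ord0 addr0.
rewrite exprMn sqr_sqrtr; last first.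
  apply: addr_ge0; first by rewrite mulr_ge0 ?sqr_ge0.
  by apply: sumr_ge0 => s _; exact: sqr_ge0.
rewrite mulrA -exprMn divff ?lt0r_neq0// expr1n mul1r.
by rewrite big_add1 big_mkord.
Qed.

Lemma Ddiag_step (eta gamma0 : R) (g : nat -> 'rV[R]_d) t i : 0 < eta -> 0 <= gamma0 ->
  (g t.+1 ord0 i - g t ord0 i) ^+ 2
  = eta ^+ 2 * (Ddiag eta gamma0 g t.+1 ord0 i ^+ 2 - Ddiag eta gamma0 g t ord0 i ^+ 2).
Proof. by move=> e0 g0; rewrite mulrBr !Ddiag_sq// big_ord_recr /=; ring. Qed.

Lemma Ddiag_nondecreasing (eta gamma0 : R) (g : nat -> 'rV[R]_d) t i :
  0 < eta -> 0 <= gamma0 -> Ddiag eta gamma0 g t ord0 i <= Ddiag eta gamma0 g t.+1 ord0 i.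
Proof.
move=> e0 g0; rewrite -(ler_pXn2r (ltn0Sn 1)) ?nnegrE ?Ddiag_ge0//.
rewrite -subr_ge0 -(pmulr_rge0 _ (exprn_gt0 2 e0)) -Ddiag_step//.
exact: sqr_ge0.
Qed.

(** The free parameter [q] is the expected scale of [D_T]: AM-GM trades terms linear in [D_T] for
    [D_T ^+ 2 / q], and the square is explicit by [Ddiag_sq]. *)
Lemma adapeg_dynamic_regret X (rho gamma0 eps q : R) (g x z Y xt : nat -> 'rV[R]_d)
    (x0 : 'rV[R]_d) (M : nat -> 'I_d -> R) (m : 'I_d -> R) T :
  convex_set X -> X x0 ->
  (forall u v, X u -> X v -> forall i : 'I_d, `|u ord0 i - v ord0 i| <= rho) ->
  0 < rho -> 0 <= gamma0 -> 0 < q -> 0 <= eps -> T%:R * eps <= rho ->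
  adapeg_run X rho gamma0 x0 g x z T ->
  (forall t, X (Y t)) ->
  (forall t i, (t < T)%N -> `|xt t.+1 ord0 i - x t.+1 ord0 i| <= eps) ->
  (forall t i, M t.+1 i = M t i + (Y t.+1 ord0 i - Y t ord0 i) *
     (Y t ord0 i - xt t ord0 i - 5 * (Y t ord0 i - x0 ord0 i))) ->
  (forall t i, (t <= T.+1)%N -> `|M t i| <= m i) ->
  \sum_(t < T) dotp (g t.+1) (x t.+1 - Y t.+1) <=
    4 * rho ^+ 2 * d%:R * gamma0 ^+ 2 / q
    + 4 / q * \sum_(t < T) dotp (g t.+1 - g t) (g t.+1 - g t)
    + 3 * rho ^+ 2 * d%:R * q + q / rho ^+ 2 * \sum_(i < d) m i ^+ 2
    - gamma0 / 16 * \sum_(t < T) dotp (x t.+1 - x t) (x t.+1 - x t).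
Proof.
move=> cX Xx0 diam rho0 g0 q0 eps0 Teps [ex [ez run]] XY xtx MS Mm.
pose D t i := Ddiag rho gamma0 g t ord0 i.
have Xx t : (t <= T)%N -> X (x t).
  by case: t => [|t] tT; [rewrite ex | have [[]] := run t.+1 tT].
pose S i := \sum_(t < T) (x t.+1 ord0 i - x t ord0 i) ^+ 2.
have reg : \sum_(t < T) dotp (g t.+1) (x t.+1 - Y t.+1) <=
    \sum_(i < d) (6 * rho ^+ 2 * D T i + 2 * D T i * m i - gamma0 / 16 * S i).
  apply: (@le_trans _ _ (\sum_(t < T) \sum_(i < d)
    ((g t.+1 ord0 i - g t ord0 i) * (x t.+1 ord0 i - z t.+1 ord0 i)
     - D t.+1 i / 2 * (z t.+1 ord0 i - x t.+1 ord0 i) ^+ 2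
     - D t i / 2 * (x t.+1 ord0 i - z t ord0 i) ^+ 2
     + D t i / 2 * (Y t.+1 ord0 i - z t ord0 i) ^+ 2
     - D t.+1 i / 2 * (Y t.+1 ord0 i - z t.+1 ord0 i) ^+ 2
     + (D t.+1 i - D t i) / 2 * (Y t.+1 ord0 i - x t.+1 ord0 i) ^+ 2))).
    apply: ler_sum => t _; have [xmin zmin] := run t.+1 (ltn_ord t).
    exact: extragradient_step cX xmin zmin (XY _).
  rewrite exchange_big /=; apply: ler_sum => i _.
  apply: (coordinate_regret rho gamma0 eps (m i) (x0 ord0 i) (D^~ i)
    (fun t => g t ord0 i - g t.-1 ord0 i) (fun t => x t ord0 i) (fun t => z t ord0 i)
    (fun t => Y t ord0 i) (fun t => xt t ord0 i) (M^~ i)) => //.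
  - by rewrite /D /= mxE.
  - by move=> t; exact: Ddiag_nondecreasing.
  - by move=> t /=; exact: Ddiag_step.
  - by rewrite ex ez.
  - by move=> t tT; apply: diam => //; exact: Xx.
  - by move=> t tT; exact: xtx.
  - by rewrite ez; exact: diam.
  - by move=> t; exact: diam.
  - by move=> t; exact: diam.
  - by move=> t tT; exact: Mm.
apply: le_trans reg _.
have SE : \sum_(i < d) S i = \sum_(t < T) dotp (x t.+1 - x t) (x t.+1 - x t).
  rewrite /S exchange_big; apply: eq_bigr => t _; apply: eq_bigr => i _.
  by rewrite !mxE expr2.
have GE : \sum_(i < d) (rho ^+ 2 * D T i ^+ 2) = d%:R * (rho ^+ 2 * gamma0 ^+ 2)
    + \sum_(t < T) dotp (g t.+1 - g t) (g t.+1 - g t).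
  under eq_bigr do rewrite Ddiag_sq//.
  rewrite big_split /= sumr_const card_ord mulr_natl; congr (_ + _).
  rewrite exchange_big; apply: eq_bigr => t _; apply: eq_bigr => i _.
  by rewrite !mxE expr2.
apply: (@le_trans _ _ (\sum_(i < d) (4 / q * (rho ^+ 2 * D T i ^+ 2) + 3 * rho ^+ 2 * q
    + q / rho ^+ 2 * m i ^+ 2 - gamma0 / 16 * S i))).
  apply: ler_sum => i _; rewrite lerD2r.
  (* AM-GM: [2 D <= D^2 / q + q] and [2 D m <= rho^2 D^2 / q + q m^2 / rho^2] *)
  have h1 : 2 * D T i <= D T i ^+ 2 / q + q.
    rewrite -subr_ge0 (_ : _ - _ = (D T i - q) ^+ 2 / q); last by field; rewrite lt0r_neq0.
    by rewrite divr_ge0 ?sqr_ge0// ltW.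
  have h2 : 2 * D T i * m i <= rho ^+ 2 * D T i ^+ 2 / q + q / rho ^+ 2 * m i ^+ 2.
    rewrite -subr_ge0 (_ : _ - _ = (rho ^+ 2 * D T i - q * m i) ^+ 2 / (q * rho ^+ 2)); last first.
      by field; rewrite !lt0r_neq0.
    by rewrite divr_ge0 ?sqr_ge0// mulr_ge0 ?sqr_ge0// ltW.
  have h3 := ler_wpM2l (sqr_ge0 rho) h1; lra.
rewrite sumrB !big_split /= -mulr_sumr GE -!mulr_sumr SE sumr_const card_ord -[_ *+ d]mulr_natl.
by rewrite le_eqVlt; apply/orP; left; apply/eqP; field; rewrite !lt0r_neq0.
Qed.

End Vectors.

(** * Rounding *)

Section Quantization.
Context {R : realType}.
Variables (L eps : R).
Hypotheses (L_ge0 : 0 <= L) (eps_gt0 : 0 < eps).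

Definition qsize : nat := Num.trunc (2 * L / eps).

(** Index of the cell of mesh [eps] containing [a], with left end [qval]. Values outside [[-L, L]]
    also get some index, so the map is total; accuracy is claimed only inside. *)
Definition qcode (a : R) : 'I_qsize.+1 := inord (Num.trunc ((a + L) / eps)).

Definition qval (k : 'I_qsize.+1) : R := k%:R * eps - L.

Lemma qval_norm_le k : `|qval k| <= L.
Proof.
have : (k : nat)%:R <= 2 * L / eps.
  have h : 0 <= 2 * L / eps by rewrite divr_ge0 ?mulr_ge0// ltW.
  apply: (@le_trans _ _ (qsize%:R)); first by rewrite ler_nat -ltnS.
  by rewrite /qsize truncn_le.
rewrite ler_pdivlMr// => h.
have : 0 <= (k : nat)%:R * eps by rewrite mulr_ge0 ?ler0n// ltW.
by rewrite /qval ler_norml; lra.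
Qed.

Lemma qval_qcode a : `|a| <= L -> `|qval (qcode a) - a| <= eps.
Proof.
rewrite ler_norml => /andP[La aL].
have b0 : 0 <= (a + L) / eps by rewrite divr_ge0 ?(ltW eps_gt0)//; lra.
rewrite /qval /qcode inordK; last first.
  by rewrite ltnS /qsize le_truncn// ler_pM2r ?invr_gt0//; lra.
have /andP[] := truncn_itv b0; set n := Num.trunc _.
rewrite ler_pdivlMr// ltr_pdivrMr// -natr1 => h1 h2.
by rewrite ler_norml; lra.
Qed.

Lemma measurable_qcode k : measurable [set a : R | qcode a = k].
Proof.
pose h (a : R) := Num.trunc ((a + L) / eps).
have mle n : measurable [set a | (h a <= n)%N].
  rewrite (_ : [set a | _] = `]-oo, (n.+1%:R * eps - L)[%classic); first exact: measurable_itv.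
  apply/seteqP; split => a /=; rewrite in_itv /= /h truncn_le_nat ltr_pdivrMr//; lra.
have meq n : measurable [set a | h a = n].
  case: n => [|n].
    rewrite (_ : [set a | _] = [set a | (h a <= 0)%N])//.
    by apply/seteqP; split => a /=; rewrite leqn0 => /eqP.
  rewrite (_ : [set a | _] = [set a | (h a <= n.+1)%N] `\` [set a | (h a <= n)%N]).
    exact: measurableD.
  apply/seteqP; split => a /=; first by move=> ->; rewrite ltnn.
  by move=> [h1 /negP]; rewrite -ltnNge => h2; apply/eqP; rewrite eqn_leq h1.
rewrite (_ : [set a | _] =
  \bigcup_n (if (inord n : 'I_qsize.+1) == k then [set a | h a = n] else set0)).
  by apply: bigcupT_measurable => n; case: ifP.
apply/seteqP; split => [a /= ak|a /= [n _]]; first by exists (h a) => //; rewrite /h -ak eqxx.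
by case: ifP => // /eqP <- /= <-.
Qed.

End Quantization.

(** The linear form relative to [x0] is bounded below through the coordinate diameters, so its
    infimum is approached within [eps]. *)
Lemma bounded_linear_eps_argmin (R : realType) (d : nat) (X : set 'rV[R]_d) (rho eps : R)
    (x0 f : 'rV[R]_d) : X x0 -> 0 < eps ->
  (forall u v, X u -> X v -> forall i : 'I_d, `|u ord0 i - v ord0 i| <= rho) ->
  exists y, X y /\ forall v, X v -> dotp f (y - v) <= eps.
Proof.
move=> Xx0 e0 diam.
pose S := [set dotp f (y - x0) | y in X].
have hinf : has_inf S.
  split; first by exists (dotp f (x0 - x0)), x0.
  exists (- \sum_(i < d) `|f ord0 i| * rho) => _ [y Xy <-].
  rewrite lerNl -sumrN; apply: ler_sum => i _; rewrite !mxE -mulrN.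
  rewrite (le_trans (ler_norm _))// normrM ler_wpM2l// normrN.
  exact: diam.
have [_ [y Xy <-] ylt] := inf_adherent e0 hinf.
exists y; split=> // v Xv.
have := ge_inf hinf.2 (_ : S (dotp f (v - x0))).
have -> : dotp f (y - v) = dotp f (y - x0) - dotp f (v - x0).
  by rewrite /dotp -sumrB; apply: eq_bigr => i _; rewrite !mxE; ring.
by move=> /(_ (ex_intro2 _ _ v Xv erefl)); lra.
Qed.

(** * The rounded trajectory *)

Section Dotp.
Context {R : realType} {d : nat}.
Implicit Types u v w : 'rV[R]_d.

Lemma coordB u v i : (u - v) ord0 i = u ord0 i - v ord0 i.
Proof. by rewrite !mxE. Qed.

Lemma dotpBr u v w : dotp u (v - w) = dotp u v - dotp u w.
Proof. by rewrite /dotp -sumrB; apply: eq_bigr => i _; rewrite !mxE; ring. Qed.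

Lemma dotpBl u v w : dotp (v - w) u = dotp v u - dotp w u.
Proof. by rewrite /dotp -sumrB; apply: eq_bigr => i _; rewrite !mxE; ring. Qed.

Lemma dotp_sumr n u (v : 'I_n -> 'rV[R]_d) : dotp u (\sum_t v t) = \sum_t dotp u (v t).
Proof.
rewrite /dotp exchange_big; apply: eq_bigr => i _.
by rewrite summxE mulr_sumr.
Qed.

Lemma dotp_suml n u (v : 'I_n -> 'rV[R]_d) : dotp (\sum_t v t) u = \sum_t dotp (v t) u.
Proof.
rewrite /dotp exchange_big; apply: eq_bigr => i _.
by rewrite summxE mulr_suml.
Qed.

Lemma dotpZr u v a : dotp u (a *: v) = a * dotp u v.
Proof. by rewrite /dotp mulr_sumr; apply: eq_bigr => i _; rewrite !mxE; ring. Qed.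

Lemma dotpp_ge0 u : 0 <= dotp u u.
Proof. by apply: sumr_ge0 => i _; rewrite -expr2 sqr_ge0. Qed.

Lemma norm2_sq u : norm2 u ^+ 2 = dotp u u.
Proof. by rewrite sqr_sqrtr ?dotpp_ge0. Qed.

Lemma norm2_ge0 u : 0 <= norm2 u.
Proof. exact: sqrtr_ge0. Qed.

Lemma coord_le_norm2 u i : `|u ord0 i| <= norm2 u.
Proof.
rewrite -(ler_pXn2r (ltn0Sn 1)) ?nnegrE ?norm2_ge0// norm2_sq real_normK ?num_real//.
rewrite /dotp (bigD1 i)//= -expr2 lerDl.
by apply: sumr_ge0 => j _; rewrite -expr2 sqr_ge0.
Qed.

Lemma dotp_coord_le u v (a b : R) : (forall i, `|u ord0 i| <= a) ->
  (forall i, `|v ord0 i| <= b) -> dotp u v <= d%:R * (a * b).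
Proof.
move=> ua vb; apply: (@le_trans _ _ (\sum_(i < d) a * b)).
  apply: ler_sum => i _; rewrite (le_trans (ler_norm _))// normrM ler_pM//.
by rewrite sumr_const card_ord mulr_natl.
Qed.

Lemma dotpp_add3_le u v w : dotp (u + v - w) (u + v - w) <= 3 * (dotp u u + dotp v v + dotp w w).
Proof.
rewrite /dotp -!big_split /= mulr_sumr; apply: ler_sum => i _; rewrite !mxE.
set a := u _ _; set b := v _ _; set c := w _ _.
have := sqr_ge0 (a - b); have := sqr_ge0 (a + c); have := sqr_ge0 (b + c); lra.
Qed.

Lemma dotp_le_eps u v (eps : R) : (forall i, `|v ord0 i| <= eps) -> 0 <= eps ->
  dotp u v <= eps * (d%:R + dotp u u).
Proof.
move=> ve e0; rewrite mulrDr [_ * d%:R]mulrC.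
have -> : d%:R * eps + eps * dotp u u = \sum_(i < d) eps * (1 + u ord0 i * u ord0 i).
  rewrite /dotp -mulr_sumr big_split /= sumr_const card_ord; ring.
apply: ler_sum => i _; rewrite (le_trans (ler_norm _))// normrM mulrC ler_pM//.
have := sqr_ge0 (`|u ord0 i| - 1); have := @real_normK _ (u ord0 i) (num_real _).
have := sqr_ge0 (u ord0 i); lra.
Qed.

End Dotp.

(** * Finite codes of the trajectory and their filtration *)

Section Code.
Context {R : realType} {d : nat} {dO : measure_display} {O : measurableType dO}.
Variables (T : nat) (rho L eps : R) (x0 : 'rV[R]_d).
Variables (F : 'rV[R]_d -> 'rV[R]_d) (x : nat -> O -> 'rV[R]_d).
Hypotheses (rho_ge0 : 0 <= rho) (eps_gt0 : 0 < eps).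

(** For each time and coordinate, a grid index of the point and one of the field value; thus the
    rounded field is itself a function of the code. *)
Definition code_type : finType :=
  {ffun 'I_T.+1 * 'I_d -> 'I_(qsize rho eps).+1 * 'I_(qsize L eps).+1}.

(** Blanking the entries after [t] makes codes themselves the labels of the atoms of time [t]. *)
Definition history (t : nat) (k : code_type) : code_type :=
  [ffun j : 'I_T.+1 * 'I_d => if (j.1 <= t)%N then k j else (ord0, ord0)].

Definition run_code (w : O) : code_type :=
  [ffun j : 'I_T.+1 * 'I_d => (qcode rho eps (x j.1 w ord0 j.2 - x0 ord0 j.2),
              qcode L eps (F (x j.1 w) ord0 j.2))].

(* For [t > T], [inord t] is the index 0, so that both are adapted for every [t]. *)
Definition qpoint (t : nat) (k : code_type) : 'rV[R]_d :=
  \row_i (x0 ord0 i + qval rho eps (k (inord t, i)).1).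
Definition qfield (t : nat) (k : code_type) : 'rV[R]_d :=
  \row_i qval L eps (k (inord t, i)).2.

Lemma history_refines s t k k' :
  (s <= t)%N -> history t k = history t k' -> history s k = history s k'.
Proof.
move=> st /ffunP e; apply/ffunP => j; rewrite !ffunE; case: ifP => // js.
by have := e j; rewrite !ffunE (leq_trans js st).
Qed.

Lemma history_idem t k : history t (history t k) = history t k.
Proof. by apply/ffunP => j; rewrite !ffunE; case: (j.1 <= t)%N. Qed.

Lemma history_eq t k k' (i : 'I_d) : history t k = history t k' ->
  k (inord t, i) = k' (inord t, i).
Proof.
move=> /ffunP/(_ (inord t, i)); rewrite !ffunE /=.
suff -> : ((inord t : 'I_T.+1) <= t)%N by [].
have [tT|tT] := leqP t.+1 T.+1; first by rewrite inordK.
by rewrite /inord val_insubd; case: ifP => //; rewrite ltnNge tT.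
Qed.

Lemma qpoint_adapted t : adapted_at history t (qpoint t).
Proof. by move=> k k' e; apply/rowP => i; rewrite !mxE (history_eq _ _ _ _ e). Qed.

Lemma qfield_adapted t : adapted_at history t (qfield t).
Proof. by move=> k k' e; apply/rowP => i; rewrite !mxE (history_eq _ _ _ _ e). Qed.

Lemma qpoint_le t k i : `|qpoint t k ord0 i - x0 ord0 i| <= rho.
Proof. by rewrite mxE addrC addKr qval_norm_le. Qed.

Lemma qpoint_code t w i : (t <= T)%N -> `|x t w ord0 i - x0 ord0 i| <= rho ->
  `|qpoint t (run_code w) ord0 i - x t w ord0 i| <= eps.
Proof.
move=> tT xr; rewrite mxE ffunE /= inordK ?ltnS//.
have := qval_qcode rho eps eps_gt0 _ xr.
by congr (`|_| <= _); ring.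
Qed.

Lemma qfield_code t w i : (t <= T)%N -> `|F (x t w) ord0 i| <= L ->
  `|qfield t (run_code w) ord0 i - F (x t w) ord0 i| <= eps.
Proof. by move=> tT xr; rewrite mxE ffunE /= inordK ?ltnS// qval_qcode. Qed.

(** A history event is a finite intersection over entries: an entry up to [t] contributes preimages
    of two grid cells, a blanked one either everything or the empty set. *)
Lemma history_code_sigma (gen : set (set O)) t k :
  (forall (s : nat) i B, (s <= t)%N -> (s <= T)%N -> measurable B ->
     <<s gen >> ((fun w => x s w ord0 i) @^-1` B) /\
     <<s gen >> ((fun w => F (x s w) ord0 i) @^-1` B)) ->
  <<s gen >> [set w | history t (run_code w) = k].
Proof.
move=> mx.
pose mgen := @measurable _ (g_sigma_algebraType gen).
have mD (A : set O) (Q : Prop) : mgen A -> mgen [set w | Q /\ A w].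
  move=> mA; have [q|nq] := pselect Q.
    rewrite (_ : [set w | _] = A)//.
    by apply/seteqP; split => w /=; [case | split].
  rewrite (_ : [set w | _] = set0); first exact: measurable0.
  by apply/seteqP; split => w /=; [case | ].
rewrite (_ : [set w | _] = \bigcap_(j in [set: 'I_T.+1 * 'I_d])
    [set w | history t (run_code w) j = k j]).
  apply: (@fin_bigcap_measurable _ (g_sigma_algebraType gen)) => [|j _].
    exact: finite_finset.
  case: (leqP j.1 t) => jt; last first.
    rewrite (_ : [set w | _] = [set w | ((ord0, ord0) = k j) /\ (@setT O) w]).
      by apply: mD; exact: measurableT.
    apply/seteqP; split => w /=; rewrite ffunE leqNgt jt /=; by [move=> -> | case].
  have mB : measurable [set a : R | qcode rho eps (a - x0 ord0 j.2) = (k j).1].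
    have mf : measurable_fun setT (fun a : R => a - x0 ord0 j.2) by exact: measurable_funB.
    by have := mf measurableT _ (measurable_qcode rho eps eps_gt0 (k j).1); rewrite setTI.
  have [m1 _] := mx j.1 j.2 _ jt (ltn_ord j.1) mB.
  have [_ m2] := mx j.1 j.2 _ jt (ltn_ord j.1) (measurable_qcode L eps eps_gt0 (k j).2).
  rewrite (_ : [set w | _] =
    ((fun w => x j.1 w ord0 j.2) @^-1` [set a | qcode rho eps (a - x0 ord0 j.2) = (k j).1])
    `&` ((fun w => F (x j.1 w) ord0 j.2) @^-1` [set a | qcode L eps a = (k j).2])).
    exact: (@measurableI _ (g_sigma_algebraType gen)).
  apply/seteqP; split => w /=; rewrite !ffunE jt /=.
    by move=> <-.
  by case=> -> ->; rewrite -surjective_pairing.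
apply/seteqP; split => w; first by move=> e j _; exact: (congr1 (fun h : code_type => h j) e).
by move=> h; apply/ffunP => j; exact: h.
Qed.

End Code.

(** * Expected error *)

Section AveragedIterate.
Context {R : realType} {d : nat}.
Variables (X : set 'rV[R]_d) (x : nat -> 'rV[R]_d) (T : nat).
Hypothesis T_gt0 : (0 < T)%N.

Lemma xbarE : xbar x T = T%:R^-1 *: \sum_(t < T) x t.+1.
Proof. by rewrite /xbar big_add1 big_mkord. Qed.

Lemma convex_set_xbar : convex_set X ->
  (forall t, (1 <= t <= T)%N -> X (x t)) -> X (xbar x T).
Proof.
move=> cX Xx; have TR : T%:R != 0 :> R by rewrite pnatr_eq0 -lt0n.
have := convex_set_subconvex_comb X _ (index_enum 'I_T) (fun=> T%:R^-1)
  (fun t : 'I_T => x t.+1) (x T) cX (Xx T _).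
have -> : x T + \sum_(t < T) T%:R^-1 *: (x t.+1 - x T) = xbar x T.
  rewrite xbarE -scaler_sumr sumrB sumr_const card_ord scalerBr -[x T *+ T]scaler_nat scalerA.
  by rewrite mulVf// scale1r addrC subrK.
apply=> [|t|t|]; first by rewrite T_gt0 leqnn.
- by apply: Xx; rewrite ltn_ord.
- by rewrite invr_ge0 ler0n.
- by rewrite sumr_const card_ord -[X in X <= _]mulr_natl mulfV.
Qed.

Lemma Err_ge0 (F : 'rV[R]_d -> 'rV[R]_d) u : X u -> (0 <= Err X F u)%E.
Proof.
move=> Xu; apply: ereal_sup_ubound; exists u => //.
by rewrite subrr /dotp big1// => i _; rewrite mxE mulr0.
Qed.

End AveragedIterate.

Section ExpectedError.
Context {R : realType} {d : nat} {dO : measure_display} {O : measurableType dO}.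
Variable P : probability O R.
Variables (X : set 'rV[R]_d) (F : 'rV[R]_d -> 'rV[R]_d).
Variables (rho sigma gamma0 : R) (T : nat) (x0 : 'rV[R]_d).
Variables (g x z : nat -> O -> 'rV[R]_d).
Hypothesis X_convex : convex_set X.
Hypothesis X_diam : forall u v, X u -> X v -> forall i : 'I_d, `|u ord0 i - v ord0 i| <= rho.
Hypothesis F_monotone : monotone_on X F.
Hypothesis gamma0_ge0 : 0 <= gamma0.
Hypothesis X_x0 : X x0.
Hypothesis run : forall w, adapeg_run X rho gamma0 x0 (g^~ w) (x^~ w) (z^~ w) T.
Hypothesis oracle_mean : forall t, (t <= T)%N -> forall i : 'I_d,
  is_cond_exp P (gen_sigma x t) (fun w => g t w ord0 i) (fun w => F (x t w) ord0 i).
Hypothesis oracle_var : forall t, (t <= T)%N ->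
  (\int[P]_w ((norm2 (g t w - F (x t w))) ^+ 2)%:E <= (sigma ^+ 2)%:E)%E.
Hypotheses (d_gt0 : (0 < d)%N) (rho_gt0 : 0 < rho).

Hypothesis T_gt0 : (0 < T)%N.

Variables (L q c1 : R).
Hypothesis F_le : forall u, X u -> forall i, `|F u ord0 i| <= L.
Hypothesis q_gt0 : 0 < q.
(** One hypothesis for both cases. A field bounded by [G] satisfies it with [c1 = 48 * G ^+ 2 / q];
    a smooth one with [c1 = 0] as soon as [q] is at least [192 * beta ^+ 2 / gamma0]. *)
Hypothesis F_variation : forall u v, X u -> X v ->
  12 / q * dotp (F u - F v) (F u - F v) <= gamma0 / 16 * dotp (u - v) (u - v) + c1.

(** * The bound at a fixed mesh *)

Section Discretization.
Variable eps : R.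
Hypotheses (eps_gt0 : 0 < eps) (T_eps : T%:R * eps <= rho).

Let K := @code_type R d T rho L eps.
Let hist : nat -> K -> K := history T rho L eps.
Let cd : O -> K := run_code T rho L eps x0 F x.
Let qp : nat -> K -> 'rV[R]_d := qpoint T rho L eps x0.
Let qf : nat -> K -> 'rV[R]_d := qfield T rho L eps.
Let pk (k : K) : R := fine (P [set w | cd w = k]).
Let xi (t : nat) (w : O) : 'rV[R]_d := g t w - F (x t w).

Let rho_ge0 : 0 <= rho. Proof. exact: ltW. Qed.
Let pk_ge0 k : 0 <= pk k. Proof. by rewrite fine_ge0. Qed.
Let hist_refines s t k k' : (s <= t)%N -> hist t k = hist t k' -> hist s k = hist s k'.
Proof. exact: history_refines. Qed.

Let qp_adapted t : adapted_at hist t (qp t). Proof. exact: qpoint_adapted. Qed.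
Let qf_adapted t : adapted_at hist t (qf t). Proof. exact: qfield_adapted. Qed.

Let X_x t w : (t <= T)%N -> X (x t w).
Proof.
have [ex [_ rn]] := run w.
by case: t => [|t] tT; [rewrite ex | have [[]] := rn t.+1 tT].
Qed.

Lemma measurable_gen_sigma t A : (t <= T)%N -> gen_sigma x t A -> measurable A.
Proof. by move=> tT; case: (oracle_mean t tT (Ordinal d_gt0)) => + _ _ _ _; apply. Qed.

Lemma gen_sigma_history t k : (t <= T)%N -> gen_sigma x t [set w | hist t (cd w) = k].
Proof.
move=> tT; apply: history_code_sigma => // s i B st sT mB; split.
  (* Time 0 is not among the generators of [gen_sigma], but [x 0] is constant. *)
  case: s st sT => [|s] st sT.
    have -> : (fun w => x 0%N w ord0 i) = cst (x0 ord0 i).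
      by apply/funext => w; have [-> _] := run w.
    rewrite preimage_cst; case: ifP => _.
      exact: (@measurableT _ (g_sigma_algebraType _)).
    exact: (@measurable0 _ (g_sigma_algebraType _)).
  by apply: sub_gen_smallest; exists s.+1, i, B; split=> //; rewrite st.
(* As a version of a conditional expectation, [F (x s)] is measurable for the sigma-algebra of time
   [s]. *)
have [_ _ _ hF _] := oracle_mean s sT i.
have := hF B mB; apply: sub_sigma_algebra2 => A [r [j [C [/andP[r1 rs] mC ->]]]].
by exists r, j, C; split=> //; rewrite r1 (leq_trans rs st).
Qed.

Let m_hist t k : (t <= T)%N -> measurable [set w | hist t (cd w) = k].
Proof. by move=> tT; apply: (measurable_gen_sigma t) => //; exact: gen_sigma_history. Qed.

Let histT k : hist T k = k.
Proof. by apply/ffunP => j; rewrite ffunE -ltnS ltn_ord. Qed.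

Let m_cd k : measurable [set w | cd w = k].
Proof.
rewrite (_ : [set w | _] = [set w | hist T (cd w) = k]); first exact: m_hist.
by apply/seteqP; split => w /=; rewrite histT.
Qed.

(** On each history atom [b] is constant and the noise integrates to 0, since the atom belongs to
    [gen_sigma x t]. *)
Lemma mean_le_noise t i (b : K -> R) : (t <= T)%N -> adapted_at hist t b ->
  mean_le P (fun w => xi t w ord0 i * b (cd w)) 0.
Proof.
move=> tT ab.
have [_ ig iF _ hE] := oracle_mean t tT i.
have ixi : P.-integrable setT (EFin \o (fun w => xi t w ord0 i)).
  rewrite (_ : _ \o _ = ((fun w => (g t w ord0 i)%:E) \- (fun w => (F (x t w) ord0 i)%:E))%E).
    exact: integrableB.
  by apply/funext => w /=; rewrite !mxE.
have := mean_le_mul_code P K (fun w => hist t (cd w)) (fun k => m_hist t k tT)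
  (fun w => xi t w ord0 i) b ixi.
rewrite big1 => [|k _].
  by apply: eq_mean_le => w; congr (_ * _); apply: ab; exact: history_idem.
set A := [set w | _].
have mA : measurable A by exact: m_hist.
have igA := integrableS measurableT mA (@subsetT _ _) ig.
have iFA := integrableS measurableT mA (@subsetT _ _) iF.
rewrite (_ : (\int[P]_(w in A) _)%E = 0%E) ?mulr0//.
transitivity (\int[P]_(w in A) ((g t w ord0 i)%:E - (F (x t w) ord0 i)%:E))%E.
  by apply: eq_integral => w _; rewrite !mxE EFinB.
rewrite integralB// hE; last exact: gen_sigma_history.
by rewrite subee// integrable_fin_num.
Qed.

Lemma mean_le_noise_sq t : (t <= T)%N -> mean_le P (fun w => dotp (xi t w) (xi t w)) (sigma ^+ 2).
Proof.
move=> tT; apply: mean_le_ge0.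
- apply: measurable_sum => i.
  have [_ ig iF _ _] := oracle_mean t tT i.
  have mg : measurable_fun setT (fun w => g t w ord0 i).
    by apply/measurable_EFinP; exact: measurable_int ig.
  have mF : measurable_fun setT (fun w => F (x t w) ord0 i).
    by apply/measurable_EFinP; exact: measurable_int iF.
  have mxi : measurable_fun setT (fun w => xi t w ord0 i).
    rewrite (_ : (fun w => _) = (fun w => g t w ord0 i) \- (fun w => F (x t w) ord0 i)).
      exact: measurable_funB.
    by apply/funext => w; rewrite !mxE.
  exact: measurable_funM.
- by move=> w; exact: dotpp_ge0.
- have := oracle_var t tT.
  by under eq_integral do rewrite norm2_sq.
Qed.

Section Comparator.
Variable Y : K -> 'rV[R]_d.
Hypothesis X_Y : forall k, X (Y k).
Hypothesis Y_min : forall k v, X v -> dotp (\sum_(t < T) qf t.+1 k) (Y k - v) <= eps.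

(** Centring at [x0] makes [Yt] equal to [x0] on atoms of mass 0, which keeps it in [X]. *)
Let u (i : 'I_d) (k : K) : R := Y k ord0 i - x0 ord0 i.
Let Yt (t : nat) (k : K) : 'rV[R]_d := \row_i (x0 ord0 i + fcond pk hist t (u i) k).
(* In the increment of [D_t (Y_t - z_t)^2 / 2] caused by moving [Y_t], the part linear
   in [Y_{t+1} - Y_t] is [Y_t - x_t]; rewriting the squares of the increments as
   differences of [(Y_t - x0)^2] contributes the remaining [- 5 (Y_t - x0)]. *)
Let B (i : 'I_d) (t : nat) (k : K) : R :=
  Yt t k ord0 i - qp t k ord0 i - 5 * (Yt t k ord0 i - x0 ord0 i).

Let u_le i k : `|u i k| <= rho. Proof. exact: X_diam. Qed.

Let Yt_adapted t : adapted_at hist t (Yt t).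
Proof.
by move=> k k' e; apply/rowP => i; rewrite !mxE (fcond_adapted _ _ _ _ _ _ e).
Qed.

Let X_Yt t k : X (Yt t k).
Proof.
pose a k' := if hist t k' == hist t k then pk k' / atom_mass pk hist t k else 0.
have a0 k' : 0 <= a k'.
  by rewrite /a; case: ifP => // _; rewrite divr_ge0// atom_mass_ge0.
have a1 : \sum_(k' <- index_enum K) a k' <= 1.
  rewrite /a -big_mkcond /= -mulr_suml -/(atom_mass pk hist t k).
  have [->|ne] := eqVneq (atom_mass pk hist t k) 0; first by rewrite mul0r ler01.
  by rewrite divff.
have -> : Yt t k = x0 + \sum_(k' <- index_enum K) a k' *: (Y k' - x0).
  apply/rowP => i; rewrite !mxE summxE; congr (_ + _).
  rewrite /fcond mulr_suml big_mkcond /=; apply: eq_bigr => k' _.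
  by rewrite !mxE /a; case: ifP => _; rewrite ?mul0r// /u mulrAC.
exact: convex_set_subconvex_comb X_convex X_x0 X_Y a0 a1.
Qed.

Let B_adapted i t : adapted_at hist t (B i t).
Proof.
by move=> k k' e; rewrite /B (Yt_adapted _ _ _ e) (qp_adapted _ _ _ e).
Qed.

Let B_le i t k : `|B i t k| <= 5 * rho.
Proof.
(* The factor 5 comes from [B = - 4 * (Yt - x0) - (qp - x0)]. *)
have := qpoint_le T rho L eps x0 rho_ge0 eps_gt0 t k i.
have := X_diam _ _ (X_Yt t k) X_x0 i.
by rewrite /B -/(qp t k) !ler_norml; lra.
Qed.

Let runmax i k := mrunmax pk hist (u i) (B i) T.+1 k.

(** A pathwise majorant of the gap, uniform in the comparison point. The two double sums have mean
    at most 0, and the terms with [eps] are rounding errors. *)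
Let bound (w : O) : R :=
  (4 * rho ^+ 2 * d%:R * gamma0 ^+ 2 / q + 3 * rho ^+ 2 * d%:R * q + T%:R * c1
   + eps * (1 + 2 * T%:R * d%:R * rho + T%:R * d%:R))
  + 12 / q * (\sum_(t < T) (dotp (xi t.+1 w) (xi t.+1 w) + dotp (xi t w) (xi t w)))
  + q / rho ^+ 2 * (\sum_(i < d) runmax i (cd w) ^+ 2)
  + (\sum_(t < T) \sum_(i < d)
       qf t.+1 (cd w) ord0 i * (fcond pk hist t.+1 (u i) (cd w) - u i (cd w)))
  + (\sum_(t < T) \sum_(i < d)
       xi t.+1 w ord0 i * (Yt t.+1 (cd w) ord0 i - qp t.+1 (cd w) ord0 i))
  + eps * (\sum_(t < T) dotp (xi t.+1 w) (xi t.+1 w)).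

Let regret_le w : \sum_(t < T) dotp (g t.+1 w) (x t.+1 w - Yt t.+1 (cd w)) <=
  4 * rho ^+ 2 * d%:R * gamma0 ^+ 2 / q + 3 * rho ^+ 2 * d%:R * q + T%:R * c1
  + 12 / q * (\sum_(t < T) (dotp (xi t.+1 w) (xi t.+1 w) + dotp (xi t w) (xi t w)))
  + q / rho ^+ 2 * (\sum_(i < d) runmax i (cd w) ^+ 2).
Proof.
have := adapeg_dynamic_regret X rho gamma0 eps q (g^~ w) (x^~ w) (z^~ w)
  (fun t => Yt t (cd w)) (fun t => qp t (cd w)) x0
  (fun t i => mtransform pk hist (u i) (B i) t (cd w)) (fun i => runmax i (cd w)) T
  X_convex X_x0 X_diam rho_gt0 gamma0_ge0 q_gt0 (ltW eps_gt0) T_eps (run w)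
  (fun t => X_Yt t (cd w)).
move=> /(_ _ _ _)/le_trans -> //.
- move=> t i tT; apply: qpoint_code => //.
  by apply: X_diam => //; exact: X_x.
- move=> t i; rewrite mtransformS /B !mxE; congr (_ + _ * _); ring.
- by move=> t i tT; exact: mtransform_le_mrunmax.
rewrite /=.
(* An increment of [g] is a field increment plus two noises; the factor 3 of [dotpp_add3_le] turns
   [4 / q] into [12 / q]. *)
suff : 4 / q * (\sum_(t < T) dotp (g t.+1 w - g t w) (g t.+1 w - g t w)) <=
    T%:R * c1 + 12 / q * (\sum_(t < T) (dotp (xi t.+1 w) (xi t.+1 w) + dotp (xi t w) (xi t w)))
    + gamma0 / 16 * \sum_(t < T) dotp (x t.+1 w - x t w) (x t.+1 w - x t w) by lra.
have -> : T%:R * c1 = \sum_(t < T) c1 by rewrite sumr_const card_ord mulr_natl.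
rewrite !mulr_sumr -!big_split /=; apply: ler_sum => t _.
have FV := F_variation _ _ (X_x t.+1 w (ltn_ord t)) (X_x t w (ltnW (ltn_ord t))).
have := dotpp_add3_le (F (x t.+1 w) - F (x t w)) (xi t.+1 w) (xi t w).
have -> : F (x t.+1 w) - F (x t w) + xi t.+1 w - xi t w = g t.+1 w - g t w.
  by apply/rowP => i; rewrite !mxE; ring.
have q4 : 0 <= 4 / q by rewrite divr_ge0// ltW.
move=> /(ler_wpM2l q4); lra.
Qed.

(** Monotonicity moves the field from [y] to the iterates ([h1], with rounding); then [y] becomes
    the near-optimal [Y] ([h2]), [Y] its conditional mean [Yt] ([h3]), and the field the oracle
    answer ([h4]). What remains is the regret. *)
Let gap_le_bound w y : X y -> \sum_(t < T) dotp (F y) (x t.+1 w - y) <= bound w.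
Proof.
move=> Xy.
have Xxt (t : 'I_T) : X (x t.+1 w) by apply: X_x; exact: ltn_ord.
have qfF (t : 'I_T) i : `|(qf t.+1 (cd w) - F (x t.+1 w)) ord0 i| <= eps.
  by rewrite coordB; apply: qfield_code => //; exact: F_le.
have qxx (t : 'I_T) i : `|(qp t.+1 (cd w) - x t.+1 w) ord0 i| <= eps.
  by rewrite coordB; apply: qpoint_code => //; exact: X_diam.
have h1 : \sum_(t < T) dotp (F y) (x t.+1 w - y)
    <= \sum_(t < T) dotp (qf t.+1 (cd w)) (x t.+1 w - y) + \sum_(t < T) d%:R * (eps * rho).
  rewrite -big_split /=; apply: ler_sum => t _.
  have m1 := F_monotone _ _ (Xxt t) Xy; rewrite dotpBl in m1.
  have dy i : `|(y - x t.+1 w) ord0 i| <= rho by rewrite coordB; exact: X_diam.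
  have := dotp_coord_le _ _ eps rho (qfF t) dy.
  rewrite dotpBl !dotpBr; rewrite !dotpBr in m1; lra.
have h2 : \sum_(t < T) dotp (qf t.+1 (cd w)) (x t.+1 w - y)
    <= \sum_(t < T) dotp (qf t.+1 (cd w)) (x t.+1 w - Y (cd w)) + eps.
  rewrite -lerBlDl -sumrB.
  have := Y_min (cd w) y Xy; rewrite dotp_suml => /(le_trans _); apply.
  by apply: ler_sum => t _; rewrite !dotpBr; lra.
have h3 : \sum_(t < T) dotp (qf t.+1 (cd w)) (x t.+1 w - Y (cd w))
    <= \sum_(t < T) dotp (F (x t.+1 w)) (x t.+1 w - Yt t.+1 (cd w))
      + \sum_(t < T) d%:R * (eps * rho)
      + \sum_(t < T) \sum_(i < d)
       qf t.+1 (cd w) ord0 i * (fcond pk hist t.+1 (u i) (cd w) - u i (cd w)).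
  rewrite -!big_split /=; apply: ler_sum => t _.
  have dY i : `|(x t.+1 w - Yt t.+1 (cd w)) ord0 i| <= rho by rewrite coordB; exact: X_diam.
  have := dotp_coord_le _ _ eps rho (qfF t) dY.
  have -> : \sum_(i < d) qf t.+1 (cd w) ord0 i * (fcond pk hist t.+1 (u i) (cd w) - u i (cd w))
     = dotp (qf t.+1 (cd w)) (Yt t.+1 (cd w) - Y (cd w)).
    by apply: eq_bigr => i _; rewrite !mxE /u; ring.
  rewrite dotpBl !dotpBr; lra.
(* The noise may be tested only against functions of the code, so [x] is replaced by [qp], at the
   cost of the last group of terms. *)
have h4 : \sum_(t < T) dotp (F (x t.+1 w)) (x t.+1 w - Yt t.+1 (cd w))
    <= \sum_(t < T) dotp (g t.+1 w) (x t.+1 w - Yt t.+1 (cd w))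
     + \sum_(t < T) \sum_(i < d)
       xi t.+1 w ord0 i * (Yt t.+1 (cd w) ord0 i - qp t.+1 (cd w) ord0 i)
     + (\sum_(t < T) eps * d%:R + eps * \sum_(t < T) dotp (xi t.+1 w) (xi t.+1 w)).
  rewrite mulr_sumr -!big_split /=; apply: ler_sum => t _.
  have -> : \sum_(i < d) xi t.+1 w ord0 i * (Yt t.+1 (cd w) ord0 i - qp t.+1 (cd w) ord0 i)
     = dotp (xi t.+1 w) (Yt t.+1 (cd w) - qp t.+1 (cd w)).
    by apply: eq_bigr => i _; rewrite !mxE.
  have := dotp_le_eps (xi t.+1 w) _ eps (qxx t) (ltW eps_gt0).
  rewrite /xi !dotpBl !dotpBr; lra.
have h5 := regret_le w.
have sumc (c : R) : \sum_(t < T) c = T%:R * c by rewrite sumr_const card_ord mulr_natl.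
rewrite !sumc in h1 h3 h4.
rewrite /bound; lra.
Qed.

Let mean_le_bound : mean_le P bound
  (4 * rho ^+ 2 * d%:R * gamma0 ^+ 2 / q + 103 * rho ^+ 2 * d%:R * q + T%:R * c1
   + 24 / q * T%:R * sigma ^+ 2
   + eps * (1 + 2 * T%:R * d%:R * rho + T%:R * d%:R + T%:R * sigma ^+ 2)).
Proof.
have sumc (n : nat) (c : R) : \sum_(t < n) c = n%:R * c.
  by rewrite sumr_const card_ord mulr_natl.
apply: mean_leW; last first.
  apply: mean_leD; last first.
    apply: mean_leZ; first exact: ltW.
    by apply: mean_le_sum => t; apply: mean_le_noise_sq; exact: ltn_ord.
  apply: mean_leD; last first.
    apply: mean_le_sum => t; apply: mean_le_sum => i.
    apply: (mean_le_noise t.+1 i (fun k => Yt t.+1 k ord0 i - qp t.+1 k ord0 i)).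
      exact: ltn_ord.
    by move=> k k' e; rewrite (Yt_adapted _ _ _ e) (qp_adapted _ _ _ e).
  apply: mean_leD; last first.
    apply: mean_le_sum => t; apply: mean_le_sum => i.
    apply: (mean_leW P _ _ 0); last first.
      exact: (mean_le_code P K cd m_cd
        (fun k => qf t.+1 k ord0 i * (fcond pk hist t.+1 (u i) k - u i k))).
    (* The rounded field is adapted, so in the mean [Y] and its conditional expectation agree
       against it. *)
    rewrite -[X in X <= _]/(fexp pk _).
    rewrite (@eq_fexp _ _ pk _ (fun k => qf t.+1 k ord0 i * fcond pk hist t.+1 (u i) k
      - qf t.+1 k ord0 i * u i k)); last by move=> k; rewrite mulrBr.
    rewrite fexpB fexp_fcond ?subrr//.
    by move=> k k' e; rewrite (qf_adapted _ _ _ e).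
  apply: mean_leD; last first.
    apply: mean_leZ; first by rewrite divr_ge0 ?sqr_ge0// ltW.
    apply: mean_le_sum => i.
    apply: (mean_leW P _ _ (100 * rho ^+ 4)); last first.
      exact: (mean_le_code P K cd m_cd (fun k => runmax i k ^+ 2)).
    (* Doob's bound is [4 * (5 * rho) ^+ 2 * rho ^+ 2], that is [100 * rho ^+ 4]; together with the
       3 of the regret it gives 103. *)
    have := @fexp_mrunmax_sq _ _ pk hist pk_ge0 hist_refines (u i) (B i) (5 * rho) rho
      rho_ge0 (u_le i) (B_adapted i) (B_le i) T.+1.
    rewrite (sum_code_probability P K cd m_cd) => /le_trans; apply; lra.
  apply: mean_leD; first exact: mean_le_cst.
  apply: mean_leZ; first by rewrite divr_ge0// ltW.
  apply: mean_le_sum => t; apply: mean_leD; apply: mean_le_noise_sq; first exact: ltn_ord.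
  exact: ltnW (ltn_ord t).
rewrite !sumc !mulr0.
rewrite le_eqVlt; apply/orP; left; apply/eqP; field.
by rewrite !lt0r_neq0.
Qed.

Lemma expected_err_le_comparator :
  (\int[P]_w Err X F (xbar (x^~ w) T) <= (T%:R^-1 *
    (4 * rho ^+ 2 * d%:R * gamma0 ^+ 2 / q + 103 * rho ^+ 2 * d%:R * q + T%:R * c1
     + 24 / q * T%:R * sigma ^+ 2
     + eps * (1 + 2 * T%:R * d%:R * rho + T%:R * d%:R + T%:R * sigma ^+ 2)))%:E)%E.
Proof.
have TR : 0 < T%:R :> R by rewrite ltr0n.
apply: (integral_le_mean P _ (fun w => T%:R^-1 * bound w)).
- move=> w; apply: Err_ge0; apply: convex_set_xbar => // t tT.
  by apply: X_x; case/andP: tT.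
- move=> w; apply: ge_ereal_sup => _ [y Xy <-]; rewrite lee_fin.
  have Ti : 0 <= T%:R^-1 :> R by rewrite invr_ge0 ltW.
  apply: le_trans (ler_wpM2l Ti (gap_le_bound w y Xy)).
  rewrite xbarE dotpBr dotpZr dotp_sumr.
  under [X in _ <= _ * X]eq_bigr do rewrite dotpBr.
  rewrite sumrB sumr_const card_ord mulrBr -[X in _ <= _ - _ * X]mulr_natl mulKf//.
  by rewrite lt0r_neq0.
- by apply: mean_leZ mean_le_bound; rewrite invr_ge0 ltW.
Qed.

End Comparator.

Lemma expected_err_le_eps :
  (\int[P]_w Err X F (xbar (x^~ w) T) <= (T%:R^-1 *
    (4 * rho ^+ 2 * d%:R * gamma0 ^+ 2 / q + 103 * rho ^+ 2 * d%:R * q + T%:R * c1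
     + 24 / q * T%:R * sigma ^+ 2
     + eps * (1 + 2 * T%:R * d%:R * rho + T%:R * d%:R + T%:R * sigma ^+ 2)))%:E)%E.
Proof.
have /choice[Y hY] (k : K) : exists y, X y /\
    forall v, X v -> dotp (\sum_(t < T) qf t.+1 k) (y - v) <= eps.
  exact: (bounded_linear_eps_argmin _ _ X rho eps x0).
apply: (expected_err_le_comparator Y) => [k|k v]; first by case: (hY k).
by case: (hY k) => _; apply.
Qed.

End Discretization.

Lemma expected_err_le :
  (\int[P]_w Err X F (xbar (x^~ w) T) <= (T%:R^-1 *
    (4 * rho ^+ 2 * d%:R * gamma0 ^+ 2 / q + 103 * rho ^+ 2 * d%:R * q + T%:R * c1
     + 24 / q * T%:R * sigma ^+ 2))%:E)%E.
Proof.
have TR : 0 < T%:R :> R by rewrite ltr0n.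
apply/lee_addgt0Pr => e e0; rewrite -EFinD.
pose c := 1 + 2 * T%:R * d%:R * rho + T%:R * d%:R + T%:R * sigma ^+ 2 : R.
have c0 : 0 < c.
  have h1 : 0 <= T%:R * d%:R :> R by rewrite mulr_ge0 ?ler0n.
  have h2 := mulr_ge0 h1 (ltW rho_gt0).
  have h3 := mulr_ge0 (ltW TR) (sqr_ge0 sigma).
  by rewrite /c; lra.
(* The first bound is the mesh condition, the second makes the rounding error at most [e]. *)
pose eps := Num.min (rho / T%:R) (e * T%:R / c).
have eps0 : 0 < eps.
  by rewrite lt_min; apply/andP; split; apply: divr_gt0 => //; exact: mulr_gt0.
have Teps : T%:R * eps <= rho.
  by rewrite mulrC -ler_pdivlMr// ge_min lexx.
apply: le_trans (expected_err_le_eps eps eps0 Teps) _.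
rewrite -/c lee_fin mulrDr lerD2l ler_pdivrMl// -ler_pdivlMr//.
by rewrite [T%:R * e]mulrC ge_min lexx orbT.
Qed.

End ExpectedError.

(** * Rates *)

Lemma sqr_div_le (R : realFieldType) (a q : R) : 0 <= a -> a <= q -> a ^+ 2 / q <= a.
Proof.
move=> a0 aq; have [q0|q0] := eqVneq q 0; first by rewrite q0 invr0 mulr0.
have qp : 0 < q by rewrite lt_def q0 (le_trans a0).
by rewrite ler_pdivrMr// expr2 ler_wpM2l.
Qed.

(* [s] is the scale of [D_T] per unit of oracle magnitude: [rho^2 d s^2 = T] *)
Lemma rate_nonsmooth (R : realType) (d T : nat) (rho gamma0 sigma G q e : R) :
  (0 < d)%N -> (0 < T)%N -> 0 < rho -> 0 <= gamma0 -> 0 <= sigma -> 0 <= G -> 0 < e ->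
  let s := Num.sqrt T%:R / (Num.sqrt d%:R * rho) in
  q = gamma0 + s * (G + sigma) + e ->
  T%:R^-1 * (4 * rho ^+ 2 * d%:R * gamma0 ^+ 2 / q + 103 * rho ^+ 2 * d%:R * q
    + T%:R * (48 * G ^+ 2 / q) + 24 / q * T%:R * sigma ^+ 2)
  <= 151 * (gamma0 * d%:R * rho ^+ 2 / T%:R
     + (Num.sqrt d%:R * rho * G + Num.sqrt d%:R * rho * sigma) / Num.sqrt T%:R)
     + 103 * rho ^+ 2 * d%:R / T%:R * e.
Proof.
move=> d0 T0 rho0 g0 s0 G0 e0 s.
have A0 : 0 < Num.sqrt T%:R :> R by rewrite sqrtr_gt0 ltr0n.
have B0 : 0 < Num.sqrt d%:R :> R by rewrite sqrtr_gt0 ltr0n.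
have AE : T%:R = Num.sqrt T%:R ^+ 2 :> R by rewrite sqr_sqrtr ?ler0n.
have BE : d%:R = Num.sqrt d%:R ^+ 2 :> R by rewrite sqr_sqrtr ?ler0n.
move: AE BE A0 B0 @s; set A := Num.sqrt T%:R; set B := Num.sqrt d%:R.
move=> -> -> A0 B0 s qE.
have sp : 0 < s by rewrite divr_gt0// mulr_gt0.
have [sG ss] : 0 <= s * G /\ 0 <= s * sigma by split; apply: mulr_ge0 => //; exact: ltW.
have q0 : 0 < q by rewrite qE; lra.
have h1 : gamma0 ^+ 2 / q <= gamma0 by apply: sqr_div_le => //; rewrite qE; lra.
have h2 : (s * G) ^+ 2 / q <= s * G by apply: sqr_div_le => //; rewrite qE; lra.
have h3 : (s * sigma) ^+ 2 / q <= s * sigma by apply: sqr_div_le => //; rewrite qE; lra.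
(* As [k * s ^+ 2 = 1], every term is [k] times one on the scale of [q]. The largest coefficient is
   that of [s * G], namely [151 = 103 + 48]. *)
pose k := rho ^+ 2 * B ^+ 2 / A ^+ 2.
have k0 : 0 <= k by apply: divr_ge0; [apply: mulr_ge0|]; exact: sqr_ge0.
have -> : (A ^+ 2)^-1 * (4 * rho ^+ 2 * B ^+ 2 * gamma0 ^+ 2 / q + 103 * rho ^+ 2 * B ^+ 2 * q
    + A ^+ 2 * (48 * G ^+ 2 / q) + 24 / q * A ^+ 2 * sigma ^+ 2)
  = k * (4 * (gamma0 ^+ 2 / q) + 103 * q + 48 * ((s * G) ^+ 2 / q) + 24 * ((s * sigma) ^+ 2 / q)).
  by rewrite /k /s; field; rewrite !lt0r_neq0.
have -> : 151 * (gamma0 * B ^+ 2 * rho ^+ 2 / A ^+ 2 + (B * rho * G + B * rho * sigma) / A)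
     + 103 * rho ^+ 2 * B ^+ 2 / A ^+ 2 * e
  = k * (151 * (gamma0 + s * G + s * sigma) + 103 * e).
  by rewrite /k /s; field; rewrite !lt0r_neq0.
by rewrite ler_wpM2l//; rewrite qE in h1 h2 h3 *; lra.
Qed.

Lemma rate_smooth (R : realType) (d T : nat) (rho gamma0 sigma beta q : R) :
  (0 < d)%N -> (0 < T)%N -> 0 < rho -> 0 < gamma0 -> 0 <= sigma ->
  let s := Num.sqrt T%:R / (Num.sqrt d%:R * rho) in
  q = gamma0 + s * sigma + 192 * beta ^+ 2 / gamma0 ->
  T%:R^-1 * (4 * rho ^+ 2 * d%:R * gamma0 ^+ 2 / q + 103 * rho ^+ 2 * d%:R * q
    + T%:R * 0 + 24 / q * T%:R * sigma ^+ 2)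
  <= 19776 * ((gamma0 * d%:R * rho ^+ 2 + gamma0^-1 * d%:R * rho ^+ 2 * beta ^+ 2) / T%:R
     + Num.sqrt d%:R * rho * sigma / Num.sqrt T%:R).
Proof.
move=> d0 T0 rho0 g0 s0 s.
have A0 : 0 < Num.sqrt T%:R :> R by rewrite sqrtr_gt0 ltr0n.
have B0 : 0 < Num.sqrt d%:R :> R by rewrite sqrtr_gt0 ltr0n.
have AE : T%:R = Num.sqrt T%:R ^+ 2 :> R by rewrite sqr_sqrtr ?ler0n.
have BE : d%:R = Num.sqrt d%:R ^+ 2 :> R by rewrite sqr_sqrtr ?ler0n.
move: AE BE A0 B0 @s; set A := Num.sqrt T%:R; set B := Num.sqrt d%:R.
move=> -> -> A0 B0 s qE.
have sp : 0 < s by rewrite divr_gt0// mulr_gt0.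
have ss : 0 <= s * sigma by apply: mulr_ge0 => //; exact: ltW.
have bb : 0 <= beta ^+ 2 / gamma0 by rewrite divr_ge0 ?sqr_ge0// ltW.
have q0 : 0 < q by rewrite qE; lra.
have h1 : gamma0 ^+ 2 / q <= gamma0 by apply: sqr_div_le; rewrite ?qE; lra.
have h3 : (s * sigma) ^+ 2 / q <= s * sigma by apply: sqr_div_le => //; rewrite qE; lra.
pose k := rho ^+ 2 * B ^+ 2 / A ^+ 2.
have k0 : 0 <= k by apply: divr_ge0; [apply: mulr_ge0|]; exact: sqr_ge0.
have -> : (A ^+ 2)^-1 * (4 * rho ^+ 2 * B ^+ 2 * gamma0 ^+ 2 / q + 103 * rho ^+ 2 * B ^+ 2 * q
    + A ^+ 2 * 0 + 24 / q * A ^+ 2 * sigma ^+ 2)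
  = k * (4 * (gamma0 ^+ 2 / q) + 103 * q + 24 * ((s * sigma) ^+ 2 / q)).
  by rewrite /k /s; field; rewrite !lt0r_neq0.
have -> : (gamma0 * B ^+ 2 * rho ^+ 2 + gamma0^-1 * B ^+ 2 * rho ^+ 2 * beta ^+ 2) / A ^+ 2
     + B * rho * sigma / A
  = k * (gamma0 + beta ^+ 2 / gamma0 + s * sigma).
  by rewrite /k /s; field; rewrite !lt0r_neq0.
(* The largest coefficient is that of [beta ^+ 2 / gamma0], namely [19776 = 103 * 192]. *)
rewrite [leRHS]mulrCA ler_wpM2l//; rewrite qE in h1 h3 *; lra.
Qed.

Theorem theoremF1 :
  exists C : nat,
  forall (R : realType) (d : nat) (dO : measure_display) (O : measurableType dO)
    (P : probability O R) (X : set 'rV[R]_d) (F : 'rV[R]_d -> 'rV[R]_d)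
    (Rd Rinf sigma gamma0 : R) (T : nat) (x0 : 'rV[R]_d)
    (g x z : nat -> O -> 'rV[R]_d),
  X !=set0 -> closed X -> convex_set X -> bounded_set X ->
  (forall u v, X u -> X v -> norm2 (u - v) <= Rd) ->
  (forall u v, X u -> X v -> forall i : 'I_d, `|u ord0 i - v ord0 i| <= Rinf) ->
  monotone_on X F ->
  0 <= sigma -> 0 <= gamma0 -> (0 < T)%N -> X x0 ->
  (* the iterates are a run of AdaPEG-Vector with eta = R_infty *)
  (forall w, adapeg_run X Rinf gamma0 x0 (g^~ w) (x^~ w) (z^~ w) T) ->
  (* g t = stochastic oracle answer at x_t *)
  (forall t, (t <= T)%N -> forall i : 'I_d,
     is_cond_exp P (gen_sigma x t) (fun w => g t w ord0 i) (fun w => F (x t w) ord0 i)) ->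
  (forall t, (t <= T)%N ->
     (\int[P]_w ((norm2 (g t w - F (x t w))) ^+ 2)%:E <= (sigma ^+ 2)%:E)%E) ->
  (forall G : R, (exists u, X u /\ norm2 (F u) = G) -> (forall u, X u -> norm2 (F u) <= G) ->
     (\int[P]_w Err X F (xbar (x^~ w) T)
       <= (C%:R * (gamma0 * d%:R * Rinf ^+ 2 / T%:R
              + (Num.sqrt d%:R * Rinf * G + (Num.sqrt d%:R * Rinf + Rd) * sigma)
                / Num.sqrt T%:R))%:E)%E)
  /\
  (forall beta : R, smooth_on X F beta -> 0 < gamma0 ->
     (\int[P]_w Err X F (xbar (x^~ w) T)
       <= (C%:R * ((gamma0 * d%:R * Rinf ^+ 2 + gamma0^-1 * d%:R * Rinf ^+ 2 * beta ^+ 2) / T%:R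
              + (Num.sqrt d%:R * Rinf + Rd) * sigma / Num.sqrt T%:R))%:E)%E).
Proof.
(* This dominates the constants 151 and 19776 of the two rates. *)
exists (200 * 100)%N => R d dO O P X F Rd Rinf sigma gamma0 T x0 g x z _ _ cX _ diam2 diam
  Fmono s0 g0 T0 Xx0 hrun hmean hvar.
rewrite natrM.
have Rd0 : 0 <= Rd by apply: le_trans (diam2 x0 x0 Xx0 Xx0); exact: norm2_ge0.
have A0 : 0 < Num.sqrt T%:R :> R by rewrite sqrtr_gt0 ltr0n.
have TR : 0 < T%:R :> R by rewrite ltr0n.
have Rds : 0 <= Rd * sigma / Num.sqrt T%:R.
  by rewrite divr_ge0 ?mulr_ge0// ltW.
have dr : d = 0%N \/ (0 < d)%N /\ 0 <= Rinf.
  case: (posnP d) => [->|d0]; [by left | right; split=> //].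
  by apply: le_trans (diam x0 x0 Xx0 Xx0 (Ordinal d0)).
have dr1 : 0 <= Num.sqrt d%:R * Rinf.
  by case: dr => [->|[_ ?]]; rewrite ?sqrtr0 ?mul0r// mulr_ge0 ?sqrtr_ge0.
have dr2 : 0 <= d%:R * Rinf ^+ 2 by rewrite mulr_ge0 ?ler0n ?sqr_ge0.
have iT : 0 <= T%:R^-1 :> R by rewrite invr_ge0 ltW.
have iA : 0 <= (Num.sqrt T%:R)^-1 :> R by rewrite invr_ge0 ltW.
have p1 := mulr_ge0 (mulr_ge0 g0 dr2) iT.
have p2 a (a0 : 0 <= a) := mulr_ge0 (mulr_ge0 dr1 a0) iA.
have p3 (b : R) : 0 <= gamma0^-1 * (d%:R * Rinf ^+ 2) * b ^+ 2 / T%:R.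
  by apply: mulr_ge0 => //; apply: mulr_ge0 (sqr_ge0 b); apply: mulr_ge0; rewrite ?invr_ge0.
have p4 := p2 sigma s0.
(* If [d = 0] or [Rinf <= 0], then [X] is a single point and the error vanishes. *)
have [/andP[d0 r0]|triv] := boolP ((0 < d)%N && (0 < Rinf)); last first.
  have eqX u v i : X u -> X v -> u ord0 i = v ord0 i.
    move=> Xu Xv; have d0 : (0 < d)%N by apply: leq_ltn_trans (ltn_ord i).
    rewrite d0 /= -leNgt in triv.
    apply/eqP; rewrite -subr_eq0 -normr_le0; exact: le_trans (diam u v Xu Xv i) triv.
  have Err0 : (\int[P]_w Err X F (xbar (x^~ w) T) <= 0%:E)%E.
    have Xxbar w : X (xbar (x^~ w) T).
      apply: convex_set_xbar => // t tT; have [_ [_ rn]] := hrun w.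
      by have [[]] := rn t tT.
    apply: (integral_le_mean P _ (fun=> 0)); last exact: mean_le_cst.
      by move=> w; apply: Err_ge0.
    move=> w; apply: ge_ereal_sup => _ [y Xy <-]; rewrite lee_fin /dotp big1// => i _.
    by rewrite coordB (eqX _ y i (Xxbar w) Xy) subrr mulr0.
  split=> [G [u [Xu uG]] FG|beta _ gp]; apply: le_trans Err0 _; rewrite lee_fin.
    have G0 : 0 <= G by rewrite -uG norm2_ge0.
    by have := p2 G G0; lra.
  by have := p3 beta; lra.
pose s := Num.sqrt T%:R / (Num.sqrt d%:R * Rinf).
have sp : 0 < s by rewrite divr_gt0// mulr_gt0// sqrtr_gt0 ltr0n.
have split3 (a b c : R) : (a + (b + c) * sigma) / Num.sqrt T%:R
    = (a + b * sigma) / Num.sqrt T%:R + c * sigma / Num.sqrt T%:R by ring.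
split=> [G [u0 [Xu0 uG]] FG|beta Fsm gp].
  have G0 : 0 <= G by rewrite -uG norm2_ge0.
  apply/lee_addgt0Pr => e e0; rewrite -EFinD.
  pose c := 103 * Rinf ^+ 2 * d%:R / T%:R.
  have c0 : 0 < c by rewrite divr_gt0// !mulr_gt0 ?exprn_gt0 ?ltr0n.
  (* The summand [e / c] keeps [q] positive even when [gamma0], [G] and [sigma] all vanish; it adds
     exactly [e] to the bound. *)
  pose q := gamma0 + s * (G + sigma) + e / c.
  have ec : 0 < e / c by exact: divr_gt0.
  have sG : 0 <= s * (G + sigma) by rewrite mulr_ge0 ?addr_ge0// ltW.
  have q0 : 0 < q by rewrite /q; lra.
  have := @expected_err_le _ _ _ _ P X F Rinf sigma gamma0 T x0 g x z cX diam Fmono g0 Xx0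
    hrun hmean hvar d0 r0 T0 G q (48 * G ^+ 2 / q).
  have Fle u : X u -> forall i, `|F u ord0 i| <= G.
    by move=> Xu i; exact: le_trans (coord_le_norm2 _ i) (FG u Xu).
  have Fvar u v : X u -> X v -> 12 / q * dotp (F u - F v) (F u - F v)
      <= gamma0 / 16 * dotp (u - v) (u - v) + 48 * G ^+ 2 / q.
    move=> Xu Xv.
    have h : dotp (F u - F v) (F u - F v) <= 4 * G ^+ 2.
      have h1 : dotp (F u - F v) (F u - F v) <= 2 * dotp (F u) (F u) + 2 * dotp (F v) (F v).
        rewrite /dotp !mulr_sumr -big_split /=; apply: ler_sum => i _; rewrite coordB.
        by have := sqr_ge0 (F u ord0 i + F v ord0 i); lra.
      have sq w : X w -> dotp (F w) (F w) <= G ^+ 2.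
        by move=> Xw; rewrite -norm2_sq lerXn2r ?nnegrE ?norm2_ge0// FG.
      by have := sq u Xu; have := sq v Xv; lra.
    have q12 : 0 <= 12 / q by rewrite divr_ge0// ltW.
    have := ler_wpM2l q12 h.
    have : 0 <= gamma0 / 16 * dotp (u - v) (u - v) by rewrite mulr_ge0 ?dotpp_ge0// divr_ge0.
    lra.
  move=> /(_ Fle q0 Fvar) /le_trans; apply; rewrite lee_fin.
  apply: le_trans (rate_nonsmooth R d T Rinf gamma0 sigma G q (e / c) d0 T0 r0 g0 s0 G0 ec erefl) _.
  rewrite -/c [c * _]mulrC divfK ?lt0r_neq0// lerD2r split3 addrA mulrDr.
  by have := p2 G G0; lra.
have bq : 0 <= beta ^+ 2 / gamma0 by rewrite divr_ge0 ?sqr_ge0.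
pose q := gamma0 + s * sigma + 192 * beta ^+ 2 / gamma0.
have ss : 0 <= s * sigma by rewrite mulr_ge0// ltW.
have q0 : 0 < q by rewrite /q; lra.
(* The bound on the field obtained from smoothness only fixes the range of the grid and does not
   enter the conclusion. *)
have := @expected_err_le _ _ _ _ P X F Rinf sigma gamma0 T x0 g x z cX diam Fmono g0 Xx0
    hrun hmean hvar d0 r0 T0 (norm2 (F x0) + `|beta| * Rd) q 0.
have Fle u : X u -> forall i, `|F u ord0 i| <= norm2 (F x0) + `|beta| * Rd.
  move=> Xu i.
  have h1 : `|F u ord0 i - F x0 ord0 i| <= `|beta| * Rd.
    rewrite -coordB; apply: le_trans (coord_le_norm2 _ i) _.
    apply: le_trans (Fsm u x0 Xu Xx0) _.
    apply: le_trans (ler_wpM2r (norm2_ge0 _) (ler_norm beta)) _.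
    by rewrite ler_wpM2l// diam2.
  have h2 := coord_le_norm2 (F x0) i.
  have := ler_normD (F u ord0 i - F x0 ord0 i) (F x0 ord0 i); rewrite subrK; lra.
have Fvar u v : X u -> X v -> 12 / q * dotp (F u - F v) (F u - F v)
      <= gamma0 / 16 * dotp (u - v) (u - v) + 0.
  move=> Xu Xv; rewrite addr0.
  have h : dotp (F u - F v) (F u - F v) <= beta ^+ 2 * dotp (u - v) (u - v).
    rewrite -!norm2_sq -exprMn lerXn2r ?nnegrE ?norm2_ge0 ?Fsm//.
    exact: le_trans (norm2_ge0 _) (Fsm u v Xu Xv).
  have q12 : 0 <= 12 / q by rewrite divr_ge0// ltW.
  apply: le_trans (ler_wpM2l q12 h) _; rewrite mulrA ler_wpM2r ?dotpp_ge0//.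
  rewrite mulrAC ler_pdivrMr//.
  have -> : gamma0 / 16 * q = gamma0 / 16 * (gamma0 + s * sigma) + 12 * beta ^+ 2.
    by rewrite /q; field; rewrite lt0r_neq0.
  by rewrite lerDr mulr_ge0 ?divr_ge0 ?addr_ge0.
move=> /(_ Fle q0 Fvar) /le_trans; apply; rewrite lee_fin.
apply: le_trans (rate_smooth R d T Rinf gamma0 sigma beta q d0 T0 r0 gp s0 erefl) _.
have := split3 0 (Num.sqrt d%:R * Rinf) Rd; rewrite !add0r => ->.
by have := p3 beta; lra.
Qed.
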